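(* Assume that $H$ is stable, non-degenerate (with constants $\varepsilon,B$), hereditary and invariant under translation, that $\mathbb{Q}(B(0,\varepsilon))>0$, and that either [$H$ has finite range and there exists $c>0$ with $\mathbb{E}[e^{c|X|}]<\infty$ for $X\sim\mathbb{Q}$] or [$H$ is a summable pairwise interaction and $\mathcal{Q}=\mathrm{supp}(\mathbb{Q})$ is bounded]. Assume also that $\mathbb{Q}$ has a density $\lambda_1=e^{-q}$ with respect to Lebesgue measure, with support $\mathcal{Q}$. Let $\mathbf{\Gamma}\in P_{\mathcal{L}}(H,\mathbb{Q})$ (a non-empty set), let $u\in\mathcal{D}$, and let $f:\mathcal{L}_u\times\mathbb{R}^d\times\mathcal{C}\to\mathbb{R}$ be any measurable function. (i) If $$\mathbb{E}_u\sum_{i\in\mathcal{L}_U}|f(i,X_i,\mathbf{\Gamma}_{i^c})|<\infty\quad\text{and}\quad \mathbb{E}_u\sum_{i\in\mathcal{L}_U}\int_{\mathcal{Q}}|f(i,x,\mathbf{\Gamma}_{i^c})|\,\Lambda(i,x,\mathbf{\Gamma}_{i^c})\,dx<\infty,$$ then $$\mathbb{E}_u\sum_{i\in\mathcal{L}_U}f(i,X_i,\mathbf{\Gamma}_{i^c})=\mathbb{E}_u\sum_{i\in\mathcal{L}_U}\int_{\mathcal{Q}}f(i,x,\mathbf{\Gamma}_{i^c})\,\Lambda(i,x,\mathbf{\Gamma}_{i^c})\,dx.$$ (ii) If $f(i,x,\boldsymbol{\gamma})=f(0,x,\boldsymbol{\gamma}-i)$ for all $i\in\mathcal{L}_u$,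 $x\in\mathcal{Q}$, $\boldsymbol{\gamma}\in\mathcal{C}$, and $$\mathbb{E}_u\int_{\mathcal{Q}}|f(0,x,\mathbf{\Gamma}_{0^c})|\,\Lambda(0,x,\mathbf{\Gamma}_{0^c})\,dx<\infty,$$ then for any bounded domain $W\subset\mathbb{R}^d$, $$\mathbb{E}_u\sum_{i\in\mathcal{L}_U\cap W}f(i,X_i,\mathbf{\Gamma}_{i^c})=\mathbb{E}_u\sum_{i\in\mathcal{L}_U\cap W}\int_{\mathcal{Q}}f(i,x,\mathbf{\Gamma}_{i^c})\,\Lambda(i,x,\mathbf{\Gamma}_{i^c})\,dx.$$
   Context: Lattice. $\mathcal{L}\subset\mathbb{R}^d$ is a full rank lattice generated by a basis $(a_1,\dots,a_d)$ of $\mathbb{R}^d$, with fundamental domain $\mathcal{D}=\{\sum_{i=1}^d t_ia_i:(t_1,\dots,t_d)\in[0,1)^d\}$. $\mathbb{Q}$ is a probability measure on $\mathbb{R}^d$ (the move distribution). Configurations are $\mathbf{x}=(x_i)_{i\in\mathcal{L}}\in(\mathbb{R}^d)^{\mathcal{L}}$, with restrictions $\mathbf{x}_\Lambda=(x_i)_{i\in\Lambda}$ for $\Lambda\subset\mathcal{L}$; $\Delta^c=\mathcal{L}\setminus\Delta$. Point configurations. $\mathcal{C}$ is the set of locally finite subsets of $\mathbb{R}^d$, $\mathcal{C}_f$ the set of finite ones, $\boldsymbol{\gamma}_W=\boldsymbol{\gamma}\cap W$, $N(\boldsymbol{\gamma})$ is the number of points. For $u\in\mathbb{R}^d$ and $\Lambda\subset\mathcal{L}$,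 $\mathbf{\Gamma}_\Lambda(\mathbf{x}_\Lambda,u)=\{i+x_i+u: i\in\Lambda\}$ and $\mathbf{\Gamma}(\mathbf{x},u)=\mathbf{\Gamma}_{\mathcal{L}}(\mathbf{x},u)$. Hamiltonian. $H:\mathcal{C}_f\to\mathbb{R}\cup\{\infty\}$ is measurable. For bounded $W\subset\mathbb{R}^d$, $H_W(\boldsymbol{\gamma})=\lim_{n\to\infty}\big(H(\boldsymbol{\gamma}_{[-n,n]^d})-H(\boldsymbol{\gamma}_{[-n,n]^d\setminus W})\big)$ if the limit exists, with $\infty-\infty=0$; the local energy is $h(x,\boldsymbol{\gamma})=\lim_{n\to\infty}\big(H(\{x\}\cup\boldsymbol{\gamma}_{[-n,n]^d})-H(\boldsymbol{\gamma}_{[-n,n]^d})\big)$. - Stable: there is $A\ge0$ with $H(\boldsymbol{\gamma})\ge -A\,N(\boldsymbol{\gamma})$ for all $\boldsymbol{\gamma}\in\mathcal{C}_f$. - Non-degenerate: there are $\varepsilon>0$, $B\ge0$ such that for any finite $\Lambda\subset\mathcal{L}$ and any $x_i$ with $|x_i|\le\varepsilon$, $i\in\Lambda$, $H(\{i+x_i\}_{i\in\Lambda})\le B|\Lambda|$. - Hereditary: if $\boldsymbol{\gamma}\in\mathcal{C}_f$ and $H(\boldsymbol{\gamma})=\infty$ then $H(\boldsymbol{\gamma}\cup\{x\})=\infty$ for all $x\in\mathbb{R}^d$. - Invariant under translation: $H(\boldsymbol{\gamma}+v)=H(\boldsymbol{\gamma})$ for all $v\in\mathbb{R}^d$, $\boldsymbol{\gamma}\in\mathcal{C}_f$.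 - Finite range: there is $R>0$ such that for every bounded $W\subset\mathbb{R}^d$, $H_W(\boldsymbol{\gamma})=H_W(\boldsymbol{\gamma}_{W\oplus B(0,R)})$, where $W\oplus B(0,R)=\{x+y:x\in W,y\in B(0,R)\}$. - Summable pairwise interaction: there are $\phi:\mathbb{R}^+\to\mathbb{R}\cup\{\infty\}$ monotone at infinity and $\epsilon>0$ with $H(\boldsymbol{\gamma})=\sum_{\{x,y\}\subset\boldsymbol{\gamma}}\phi(|x-y|)$ and $\int_{\mathbb{R}^+\setminus[0,\epsilon]}r^{d-1}\phi(r)\,dr<\infty$. Gibbs measures. For finite $\Lambda\subset\mathcal{L}$, $\tilde H(\mathbf{x}_\Lambda)=H(\mathbf{\Gamma}_\Lambda(\mathbf{x}_\Lambda,0))$. For finite $\Delta\subset\mathcal{L}$, $\tilde H_\Delta(\mathbf{x})=\lim_{n\to\infty}\big(\tilde H(\mathbf{x}_{\Lambda_n})-\tilde H(\mathbf{x}_{\Lambda_n\setminus\Delta})\big)$ with $\Lambda_n=[-n,n]^d\cap\mathcal{L}$ and $\infty-\infty=0$. $\mathcal{G}_{\mathcal{L}}(H,\mathbb{Q})$ is the set of probability measures $\mathbb{P}$ on $(\mathbb{R}^d)^{\mathcal{L}}$, invariant under translations of $\mathcal{L}$, such that for every finite $\Delta\subset\mathcal{L}$ and $\mathbb{P}$-a.e. $\mathbf{x}_{\Delta^c}$, $$\mathbb{P}(d\mathbf{x}'_\Delta\mid\mathbf{x}_{\Delta^c})=\frac{1}{Z_\Delta(\mathbf{x}_{\Delta^c})}e^{-\tilde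 H_\Delta(\mathbf{x}'_\Delta\cup\mathbf{x}_{\Delta^c})}\,\mathbb{Q}^{\otimes\Delta}(d\mathbf{x}'_\Delta),\qquad Z_\Delta(\mathbf{x}_{\Delta^c})=\int e^{-\tilde H_\Delta(\mathbf{x}'_\Delta\cup\mathbf{x}_{\Delta^c})}\,\mathbb{Q}^{\otimes\Delta}(d\mathbf{x}'_\Delta).$$ A Gibbs perturbed lattice is $\mathbf{\Gamma}=\mathbf{\Gamma}(\mathbf{X},U)$ with $\mathbf{X}\sim\mathbb{P}\in\mathcal{G}_{\mathcal{L}}(H,\mathbb{Q})$ and $U$ uniform on $\mathcal{D}$, independent of $\mathbf{X}$. $P_{\mathcal{L}}(H,\mathbb{Q})$ is the set of stationary Gibbs perturbed lattices. Further notation. $\mathcal{L}_u=\{k+u:k\in\mathcal{L}\}$; for $i=k+U\in\mathcal{L}_U$ write $X_i:=X_k$, so $\mathbf{\Gamma}=\{i+X_i:i\in\mathcal{L}_U\}$, and $\mathbf{\Gamma}_{i^c}=\{j+X_j:j\in\mathcal{L}_U,j\ne i\}$. $\mathbb{E}_u$ is the conditional expectation given $U=u$ (i.e. expectation with $U$ replaced by $u$). Set $\lambda_2(i+x,\boldsymbol{\gamma})=e^{-h(i+x,\boldsymbol{\gamma})}$, $\lambda(i,x,\boldsymbol{\gamma})=\lambda_1(x)\lambda_2(i+x,\boldsymbol{\gamma})$ and $\Lambda(i,x,\boldsymbol{\gamma})=\lambda(i,x,\boldsymbol{\gamma})/\int_{\mathcal{Q}}\lambda(i,y,\boldsymbol{\gamma})\,dy$.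 In (ii), the index $0$ refers to the process recentred at a site: $\mathbf{\Gamma}_{0^c}=\{k+X_k:k\in\mathcal{L}\setminus\{0\}\}$ (which has the law of $\mathbf{\Gamma}_{i^c}-i$ for any $i\in\mathcal{L}_u$), and $f(0,\cdot,\cdot)$ is a measurable function on $\mathcal{Q}\times\mathcal{C}$. *)

(* Defs.v *)
From HB Require Import structures.
From mathcomp Require Import all_boot all_order all_algebra finmap.
From mathcomp Require Import all_classical all_reals all_analysis.
From mathcomp Require Import measurable_realfun.

Set Implicit Arguments.
Unset Strict Implicit.
Unset Printing Implicit Defensive.

Import Order.TTheory GRing.Theory Num.Theory.
Import numFieldNormedType.Exports.

Local Open Scope classical_set_scope.
Local Open Scope ring_scope.

(* 'rV[R]_d carries the product sigma-algebra, generated by the coordinates; it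
   is the Borel sigma-algebra of R^d, as for the library's n.-tuple R. *)
Section measurable_rV.
Context (R : realType) (d : nat).

Let coord : 'I_d -> 'rV[R]_d -> R := fun i x => x ord0 i.

Let rV_set0 : g_sigma_preimage coord set0.
Proof. exact: sigma_algebra0. Qed.

Let rV_setC A : g_sigma_preimage coord A -> g_sigma_preimage coord (~` A).
Proof. exact: sigma_algebraC. Qed.

Let rV_bigcup (F : (set 'rV[R]_d)^nat) :
  (forall i, g_sigma_preimage coord (F i)) ->
  g_sigma_preimage coord (\bigcup_i (F i)).
Proof. exact: sigma_algebra_bigcup. Qed.

HB.instance Definition _ := @isMeasurable.Build default_measure_display
  'rV[R]_d (g_sigma_preimage coord) rV_set0 rV_setC rV_bigcup.

End measurable_rV.

Section product_tuple.
Context d (T : measurableType d) (R : realType).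
Local Open Scope ereal_scope.

Definition tcons n (p : T * n.-tuple T) : n.+1.-tuple T :=
  [tuple of p.1 :: p.2].

Lemma measurable_tcons n : measurable_fun setT (@tcons n).
Proof. exact: measurable_cons. Qed.

HB.instance Definition _ n := @isMeasurableFun.Build _ _ _ _ (@tcons n)
  (@measurable_tcons n).

Section step.
Variables (m : {sigma_finite_measure set T -> \bar R}) (n : nat).
Variable p : {sigma_finite_measure set (n.-tuple T) -> \bar R}.

Definition tuple_step : set (n.+1.-tuple T) -> \bar R :=
  pushforward (m \x p) (@tcons n).

Let tuple_step0 : tuple_step set0 = 0.
Proof. by rewrite /tuple_step /pushforward preimage_set0 measure0. Qed.

Let tuple_step_ge0 A : 0 <= tuple_step A.
Proof. exact: measure_ge0. Qed.

Let tuple_step_sigma_additive : semi_sigma_additive tuple_step.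
Proof. exact: (@measure_semi_sigma_additive _ _ _
  (pushforward (m \x p) (@tcons n : {mfun _ >-> _}))). Qed.

HB.instance Definition _ := isMeasure.Build _ _ _ tuple_step
  tuple_step0 tuple_step_ge0 tuple_step_sigma_additive.

Lemma tuple_step_sigma_finite : sigma_finite setT tuple_step.
Proof.
have /sigma_finiteP[F [TF ndF Foo]] := sigma_finiteT m.
have /sigma_finiteP[G [TG ndG Goo]] := sigma_finiteT p.
pose g (t : n.+1.-tuple T) : T * n.-tuple T := (thead t, [tuple of behead t]).
have mg : measurable_fun setT g.
  by apply: measurable_fun_pair; [exact: measurable_tnth|exact: measurable_behead].
have gK : cancel (@tcons n) g.
  by move=> [x t]; rewrite /g /tcons /=; congr pair; exact/val_inj.
exists (fun k => g @^-1` (F k `*` G k)).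
  apply/esym/seteqP; split=> // t _.
  have [i _ Fi] : (\bigcup_i F i) (g t).1 by rewrite -TF.
  have [j _ Gj] : (\bigcup_i G i) (g t).2 by rewrite -TG.
  exists (maxn i j) => //; split.
  - by move: Fi; exact/subsetPset/ndF/leq_maxl.
  - by move: Gj; exact/subsetPset/ndG/leq_maxr.
move=> k; have [mF Fk] := Foo k; have [mG Gk] := Goo k; split.
  by rewrite -[X in measurable X]setTI; apply: mg => //; exact: measurableX.
rewrite /tuple_step /pushforward -comp_preimage.
rewrite (_ : g \o @tcons n = id); last by apply/funext => x /=; rewrite gK.
by rewrite preimage_id product_measure1E// lte_mul_pinfty// ge0_fin_numE.
Qed.

HB.instance Definition _ := Measure_isSigmaFinite.Build _ _ _ tuple_step
  tuple_step_sigma_finite.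

End step.

(* the n-fold product measure of m *)
Fixpoint tuple_measure (m : {sigma_finite_measure set T -> \bar R}) (n : nat) :
    {sigma_finite_measure set (n.-tuple T) -> \bar R} :=
  match n with
  | 0%N => \d_([tuple] : 0.-tuple T)
  | n'.+1 => tuple_step m (tuple_measure m n')
  end.

End product_tuple.

Section lebesgue_rV.
Context (R : realType) (d : nat).
Local Open Scope ereal_scope.

Definition rV_of_tuple (t : d.-tuple (measurableTypeR R)) : 'rV[R]_d := (\row_i tnth t i)%R.

Lemma measurable_rV_of_tuple : measurable_fun setT rV_of_tuple.
Proof.
apply: (@measurability _ _ _ _ _ _ (\big[setU/set0]_(i < d)
  preimage_set_system setT (fun x : 'rV[R]_d => x ord0 i) measurable)) => //.
move=> _ [C + <-]; rewrite -bigcup_seq => -[i _ [B mB <-]].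
rewrite !setTI -comp_preimage (_ : _ \o _ = (fun t => tnth t i)).
  by rewrite -[X in measurable X]setTI; exact: measurable_tnth.
by apply/funext => t /=; rewrite /rV_of_tuple mxE.
Qed.

HB.instance Definition _ := @isMeasurableFun.Build _ _ _ _ rV_of_tuple
  measurable_rV_of_tuple.

Definition leb : set 'rV[R]_d -> \bar R :=
  pushforward (tuple_measure (@lebesgue_measure R) d) rV_of_tuple.

Let leb0 : leb set0 = 0.
Proof. by rewrite /leb /pushforward preimage_set0 measure0. Qed.

Let leb_ge0 A : 0 <= leb A.
Proof. by rewrite /leb /pushforward measure_ge0. Qed.

Let leb_sigma_additive : semi_sigma_additive leb.
Proof.
have mf B : measurable B -> measurable (rV_of_tuple @^-1` B).
  by move=> mB; rewrite -[X in measurable X]setTI; exact: measurable_rV_of_tuple.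
move=> F mF tF mUF; rewrite /leb /pushforward preimage_bigcup.
apply: measure_semi_sigma_additive.
- by move=> n; exact: mf.
- apply/trivIsetP => i j _ _ ij; rewrite -preimage_setI.
  by move/trivIsetP : tF => /(_ _ _ _ _ ij) ->//; rewrite preimage_set0.
- by rewrite -preimage_bigcup; exact: mf.
Qed.

HB.instance Definition _ := isMeasure.Build _ _ _ leb
  leb0 leb_ge0 leb_sigma_additive.

End lebesgue_rV.
Arguments leb {R d}.

Section geometry.
Context (R : realType) (d : nat).
Local Notation E := 'rV[R]_d.

(* the norm of the library on 'rV[R]_d is the sup norm, not this one *)
Definition enorm (x : E) : R := Num.sqrt (\sum_i x ord0 i ^+ 2).

Definition cball (x : E) (r : R) : set E := [set y | enorm (y - x) <= r].

Definition box (n : nat) : set E := [set x | forall i, `|x ord0 i| <= n%:R].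

Definition bounded_rV (W : set E) : Prop := exists n, W `<=` box n.

Definition thicken (W : set E) (r : R) : set E :=
  [set x + y | x in W & y in cball 0 r].

Definition msupport (Q : set E -> \bar R) : set E :=
  [set x | forall r, 0 < r -> (0 < Q [set y | (enorm (y - x) < r)%R])%E].

(* The rows of A are the basis vectors a_1, ..., a_d of the lattice, which is
   indexed by the integer coordinates of its points in that basis. *)
Definition latpt (A : 'M[R]_d) (k : 'rV[int]_d) : E := map_mx intr k *m A.

Definition lattice_shift (A : 'M[R]_d) (u : E) : set E :=
  [set latpt A k + u | k in setT].

Definition fundamental_domain (A : 'M[R]_d) : set E :=
  [set t *m A | t in [set t : E | forall i, 0 <= t ord0 i < 1]].

End geometry.

(* Configurations (x_i) with the product sigma-algebra; [coord_events S]
   generates the sigma-algebra of the coordinates indexed by S. *)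
Section configurations.
Context (R : realType) (d : nat).

Definition coord_events (S : set 'rV[int]_d) :
    set (set ('rV[int]_d -> 'rV[R]_d)) :=
  [set C | exists k B, [/\ S k, measurable B & C = [set x | B (x k)]]].

Definition config := g_sigma_algebraType (coord_events setT).

(* [pconf] consists of all the subsets of R^d, the locally finite ones being
   singled out by [locally_finite]; the sigma-algebra is generated by the
   counting variables of bounded Borel sets. *)
Definition counting_events : set (set (set 'rV[R]_d)) :=
  [set C | exists B n, [/\ bounded_rV B, measurable B &
                         C = [set g | (g `&` B #= `I_n)%card]]].

Definition pconf := g_sigma_algebraType counting_events.

Definition locally_finite (g : pconf) : Prop :=
  forall n, finite_set ((g : set 'rV[R]_d) `&` @box R d n).

Definition translate (g : pconf) (v : 'rV[R]_d) : pconf := [set y + v | y in g].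

(* Gamma_S(x_S, u) *)
Definition Gam (A : 'M[R]_d) (S : set 'rV[int]_d) (x : config) (u : 'rV[R]_d) :
  pconf := [set latpt A k + x k + u | k in S].

(* x'_D \cup x_{D^c}, where x'_D = t is listed along the enumeration of D *)
Definition override (D : {fset 'rV[int]_d}) (x : config)
    (t : (size D).-tuple 'rV[R]_d) : config :=
  fun k => nth (x k) t (index k D).

Definition restr_config (D : {fset 'rV[int]_d}) (x : config) :
  (size D).-tuple 'rV[R]_d := map_tuple x (in_tuple D).

Definition shift_config (j : 'rV[int]_d) (x : config) : config :=
  fun k => x (k + j).

End configurations.
Arguments locally_finite {R d}.

Section hamiltonian.
Context (R : realType) (d : nat) (A : 'M[R]_d) (H : pconf R d -> \bar R).
Local Notation E := 'rV[R]_d.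
Local Open Scope ereal_scope.

(* energy difference, with the convention oo - oo = 0 *)
Definition ediff (a b : \bar R) : \bar R :=
  if (a == +oo) && (b == +oo) then 0 else a - b.

(* H : C_f -> R \cup {oo}; its values on infinite sets are irrelevant *)
Definition is_hamiltonian : Prop :=
  measurable_fun [set g : pconf R d | finite_set g] H /\
  (forall g : pconf R d, finite_set g -> H g != -oo).

Definition local_hamiltonian (W : set E) (g : pconf R d) : \bar R :=
  limn (fun n => ediff (H (g `&` box n)) (H (g `&` (box n `\` W)))).

Definition local_energy (x : E) (g : pconf R d) : \bar R :=
  limn (fun n => ediff (H ([set x] `|` (g `&` box n))) (H (g `&` box n))).

Definition stable_hamiltonian : Prop :=
  exists2 a : R, (0 <= a)%R &
    forall s : seq E, uniq s -> (- a * (size s)%:R)%:E <= H [set` s].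

Definition nondegenerate_hamiltonian (eps B : R) : Prop :=
  [/\ (0 < eps)%R, (0 <= B)%R &
    forall (D : {fset 'rV[int]_d}) (x : config R d),
      (forall k, k \in D -> (enorm (x k) <= eps)%R) ->
      H (Gam A [set` D] x 0%R) <= (B * (#|` D|)%:R)%:E].

Definition hereditary_hamiltonian : Prop :=
  forall (g : pconf R d) (x : E), finite_set g -> H g = +oo ->
    H (g `|` [set x]) = +oo.

Definition translation_invariant : Prop :=
  forall (g : pconf R d) (v : E), finite_set g -> H (translate g v) = H g.

Definition finite_range : Prop :=
  exists2 r : R, (0 < r)%R &
    forall (W : set E) (g : pconf R d), bounded_rV W -> locally_finite g ->
      local_hamiltonian W g = local_hamiltonian W (g `&` thicken W r).

Definition monotone_at_infinity (phi : R -> \bar R) : Prop :=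
  exists r0 : R,
    (forall r s, (r0 <= r)%R -> (r <= s)%R -> phi r <= phi s) \/
    (forall r s, (r0 <= r)%R -> (r <= s)%R -> phi s <= phi r).

Definition summable_pairwise : Prop :=
  exists (phi : R -> \bar R) (e : R),
    [/\ (forall r, (0 < r)%R -> phi r != -oo),
        monotone_at_infinity phi,
        (forall s : seq E, uniq s ->
           H [set` s] = \sum_(i < size s) \sum_(j < size s | (i < j)%N)
             phi (enorm (nth 0%R s i - nth 0%R s j))),
        (0 < e)%R &
        (@lebesgue_measure R).-integrable `]e, +oo[
          (fun r => (r ^+ d.-1)%:E * phi r)].

End hamiltonian.

Section gibbs.
Context (R : realType) (d : nat) (A : 'M[R]_d) (H : pconf R d -> \bar R).
Context (Q : probability 'rV[R]_d R).
Local Open Scope ereal_scope.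

(* \tilde H(x_S) *)
Definition Htilde (S : set 'rV[int]_d) (x : config R d) : \bar R :=
  H (Gam A S x 0%R).

Definition Lam (n : nat) : set 'rV[int]_d := [set k | box n (latpt A k)].

Definition Htilde_diff (D : {fset 'rV[int]_d}) (x : config R d) (n : nat) :
  \bar R := ediff (Htilde (Lam n) x) (Htilde (Lam n `\` [set` D]) x).

(* \tilde H_D(x) *)
Definition Htilde_loc (D : {fset 'rV[int]_d}) (x : config R d) : \bar R :=
  limn (Htilde_diff D x).

(* Q^{\otimes D} *)
Definition Qprod (D : {fset 'rV[int]_d}) := tuple_measure Q (size D).

Definition partition_function (D : {fset 'rV[int]_d}) (x : config R d) :
  \bar R := \int[Qprod D]_t expeR (- Htilde_loc D (override x t)).

Definition gibbs_kernel (D : {fset 'rV[int]_d}) (x : config R d)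
    (B : set ((size D).-tuple 'rV[R]_d)) : \bar R :=
  (partition_function D x)^-1 *
  \int[Qprod D]_(t in B) expeR (- Htilde_loc D (override x t)).

(* [gibbs_kernel D] is the conditional law of X_D given X_{D^c}; the kernel is
   well defined at x when the limit \tilde H_D exists Q^{\otimes D}-a.e. and the
   partition function is positive and finite. *)
Definition gibbs_measure (P : probability (config R d) R) : Prop :=
  (forall (j : 'rV[int]_d) (C : set (config R d)), measurable C ->
     P (shift_config j @^-1` C) = P C) /\
  (forall D : {fset 'rV[int]_d},
     {ae P, forall x,
        {ae Qprod D, forall t, cvgn (Htilde_diff D (override x t))} /\
        0 < partition_function D x < +oo} /\
     (forall (B : set ((size D).-tuple 'rV[R]_d)) (C : set (config R d)),
        measurable B -> <<s coord_events (~` [set` D]) >> C ->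
        P (C `&` [set x | B (restr_config D x)]) =
        \int[P]_(x in C) gibbs_kernel x B)).

(* Gam A setT X U is a Gibbs perturbed lattice *)
Definition gibbs_perturbed_lattice d0 (Omega : measurableType d0)
    (Pr : probability Omega R) (X : {RV Pr >-> config R d})
    (U : {RV Pr >-> 'rV[R]_d}) : Prop :=
  [/\ gibbs_measure (distribution Pr X),
      (forall B, measurable B -> distribution Pr U B =
         leb (B `&` fundamental_domain A) / leb (fundamental_domain A)) &
      (forall (C : set (config R d)) (B : set 'rV[R]_d),
         measurable C -> measurable B ->
         Pr (X @^-1` C `&` U @^-1` B) = Pr (X @^-1` C) * Pr (U @^-1` B))].

(* conditional expectation given U = u of F(X, U), for U independent of X *)
Definition Eu d0 (Omega : measurableType d0) (Pr : probability Omega R)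
    (X : {RV Pr >-> config R d}) (u : 'rV[R]_d)
    (F : config R d -> 'rV[R]_d -> \bar R) : \bar R :=
  \int[Pr]_w F (X w) u.

Variable q : 'rV[R]_d -> \bar R.

Definition lambda1 (x : 'rV[R]_d) : \bar R := expeR (- q x).

Definition lambda2 (y : 'rV[R]_d) (g : pconf R d) : \bar R :=
  expeR (- local_energy H y g).

Definition lambda (i x : 'rV[R]_d) (g : pconf R d) : \bar R :=
  lambda1 x * lambda2 (i + x) g.

Definition Lambda (i x : 'rV[R]_d) (g : pconf R d) : \bar R :=
  lambda i x g / \int[leb]_(y in msupport Q) lambda i y g.

End gibbs.

(* sum of a signed family indexed by S, positive part minus negative part *)
Definition ssum (R : realType) (T : choiceType) (S : set T) (a : T -> \bar R) :
  \bar R := (\esum_(k in S) (a^\+ k) - \esum_(k in S) (a^\- k))%E.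

(* Main.v *)
Require Import Defs.
From HB Require Import structures.
From mathcomp Require Import all_boot all_order all_algebra finmap.
From mathcomp Require Import all_classical all_reals all_analysis.
From mathcomp Require Import measurable_realfun.
From mathcomp Require Import zify lra.

(** The statement is the Georgii-Nguyen-Zessin formula of a Gibbs perturbed
    lattice.  Its source is the DLR equation for the single sites [k]: given
    the other perturbations, the law of [X_k] has the density
    [exp (- H~_k) / Z_k] with respect to [Q].  Integrating a function of the
    pair ([X_k], configuration off [k]) against this conditional law, and
    summing over [k], gives the formula with [H~_k] instead of the local energy
    [h]; the work is in identifying the two and in the measurability of
    everything involved.

    - Both [H~_k] and [h] are limits of energy differences
      [H ({y} U G_n) - H (G_n)], but along different exhaustions [G_n] of the
      same configuration: by lattice boxes for [H~_k], by boxes of R^d for [h],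
      by translated boxes when the origin is moved to [u].  The lemma
      [energy_cvg] says that in a locally finite configuration the limit exists
      and is the same along every exhaustion by finite sets.  With a finite
      range the differences are eventually constant.  With a pair interaction
      they are sums of [phi (|y - p|)] over [G_n], and a monotone [phi] has a
      constant sign far away, so that the sums converge unconditionally, except
      when some finite part has infinite energy: then heredity makes the
      differences eventually zero.

    - Almost every configuration is locally finite ([config_lf_ae]): by
      stationarity the expected number of points in a box equals the expected
      number of sites [j] with [j + X_0] in the box, and this number is at most
      the number of lattice points in the box of twice the size.

    - The point configurations built from the perturbations are images of a
      countable family of measurable points, and [measurable_points] makes them
      measurable for the sigma-algebra of the counting variables; as the local
      energy is a pointwise limit, it is measurable too.

    - On rectangles, the joint law of [X_k] and of the configuration off [k] is
      given by the DLR equation; [gibbs_disintegration] extends it to all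
      non-negative functions by uniqueness of measures.  As [lambda_1] is the
      density of [Q] and [Q] is carried by its support, the integrals against
      [lambda_1 dx] on the support are integrals against [Q], and the
      normalization of [Lambda] is the partition function of the site.

    Off the locally finite configurations the integrands need not be
    measurable; [integral_null_set] removes this null set before any theorem on
    measurable functions is applied.  For (ii), translation covariance turns
    the [k]-th integral into the one at the origin evaluated at the shifted
    perturbations, so that stationarity gives the finiteness of each of the
    finitely many terms, and the argument for (i) applies to a finite sum. *)

Set Implicit Arguments.
Unset Strict Implicit.
Unset Printing Implicit Defensive.

Import Order.TTheory GRing.Theory Num.Theory.
Import numFieldNormedType.Exports.

Local Open Scope classical_set_scope.
Local Open Scope ring_scope.
Local Open Scope ereal_scope.

(** * Measures with a density, null sets and countable sums *)

Section density.
Context d (T : measurableType d) (R : realType).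
Variables (m : {measure set T -> \bar R}) (rho : T -> \bar R).
Hypothesis mrho : measurable_fun setT rho.
Hypothesis rho_ge0 : forall x, 0 <= rho x.

Lemma density_measure : exists nu : {measure set T -> \bar R},
  forall C, measurable C -> nu C = \int[m]_(x in C) rho x.
Proof.
pose nu C := \int[m]_(x in C) rho x.
have nu0 : nu set0 = 0 by exact: integral_set0.
have nu_ge0 C : 0 <= nu C by exact: integral_ge0.
have nu_sigma : semi_sigma_additive nu.
  move=> F mF tF mUF; rewrite /nu ge0_integral_bigcup//; last first.
    exact: measurable_funTS.
  by apply: is_cvg_nneseries => n _ _; exact: nu_ge0.
exists (HB.pack_for (measure T R) nu (isMeasure.Build _ _ _ nu nu0 nu_ge0 nu_sigma)).
by [].
Qed.

Import HBNNSimple.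

(** By monotone approximation it suffices to treat indicators. The factor [rho]
    may be infinite: where it is, the approximations of [g] are eventually
    positive as soon as [g] is. *)
Lemma ge0_integral_density (nu : {measure set T -> \bar R}) :
  (forall C, measurable C -> nu C = \int[m]_(x in C) rho x) ->
  forall g : T -> \bar R, measurable_fun setT g -> (forall x, 0 <= g x) ->
  \int[nu]_x g x = \int[m]_x (g x * rho x).
Proof.
move=> nuE g mg g0; pose h := nnsfun_approx measurableT mg.
have hg x : EFin \o h ^~ x @ \oo --> g x by exact: cvg_nnsfun_approx.
have hnd x : {homo (fun n => (h n x)%:E) : a b / (a <= b)%N >-> a <= b}.
  by move=> a b ab; rewrite lee_fin; exact/lefP/nd_nnsfun_approx.
have mh n : measurable_fun setT (EFin \o h n) by exact/measurable_EFinP.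
transitivity (limn (fun n => \int[nu]_x (h n x)%:E)).
  rewrite -monotone_convergence//; last by move=> n x _; rewrite lee_fin.
  by apply: eq_integral => x _; apply/esym/cvg_lim => //; exact: hg.
transitivity (limn (fun n => \int[m]_x ((h n x)%:E * rho x))); last first.
  rewrite -monotone_convergence//.
  - apply: eq_integral => x _; apply/cvg_lim => //.
    have [r0|r0] := eqVneq (rho x) 0.
      rewrite r0 mule0; under eq_fun do rewrite mule0; exact: cvg_cst.
    have rx : 0 < rho x by rewrite lt_neqAle eq_sym r0 rho_ge0.
    case: (rho x) rx => [r|_|//].
      by move=> _; apply: cvgeZr => //; exact: hg.
    have [gx0|gx0] := eqVneq (g x) 0.
      rewrite gx0 mul0e; apply: cvg_near_cst; apply: nearW => n.
      have : (h n x)%:E <= g x by rewrite /h nnsfun_approxE le_approx.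
      rewrite gx0 => hx; have -> : (h n x)%:E = 0.
        by apply/eqP; rewrite eq_le hx /= lee_fin; exact: fun_ge0.
      by rewrite mul0e.
    have gx : 0 < g x by rewrite lt_neqAle eq_sym gx0 g0.
    rewrite (gt0_muley gx); apply: cvg_near_cst.
    have [N _ hN] := hg x _ (open_ereal_gt' gx); exists N => // n /= Nn.
    by rewrite gt0_muley//; have := hN n Nn.
  - by move=> n; apply: emeasurable_funM => //; exact: mh.
  - by move=> n x _; rewrite mule_ge0// lee_fin.
  - by move=> x _ a b ab; rewrite lee_wpmul2r// hnd.
congr (limn _); apply/funext => n.
transitivity (\int[nu]_x
   (\sum_(y \in range (h n)) (y * \1_(h n @^-1` [set y]) x)%:E)).
  by apply: eq_integral => t _; rewrite /= fimfunE -fsumEFin.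
have indic r : measurable_fun setT (fun x => (r * \1_(h n @^-1` [set r]) x)%:E).
  by apply/measurable_EFinP; exact: measurable_funM.
rewrite ge0_integral_fsum//; last by move=> y x _; exact: nnfun_muleindic_ge0.
transitivity (\int[m]_x (\sum_(y \in range (h n))
    ((y * \1_(h n @^-1` [set y]) x)%:E * rho x))); last first.
  apply: eq_integral => t _; rewrite fimfunE -fsumEFin//.
  by rewrite ge0_mule_fsuml// => y; exact: nnfun_muleindic_ge0.
rewrite ge0_integral_fsum//; last 2 first.
- by move=> y; exact: emeasurable_funM.
- by move=> y x _; rewrite mule_ge0//; exact: nnfun_muleindic_ge0.
apply: eq_fsbigr => r /[!inE] -[x0 _ hr].
have r0 : (0 <= r)%R by rewrite -hr.
rewrite integralZl_indic_nnsfun// integral_indic// setIT.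
under [RHS]eq_integral do rewrite EFinM -muleA.
rewrite [RHS]ge0_integralZl_EFin//; last 2 first.
- by move=> x _; rewrite mule_ge0// lee_fin.
- by apply: emeasurable_funM => //; exact/measurable_EFinP.
congr (_ * _); rewrite nuE// integral_mkcond.
by apply: eq_integral => x _; rewrite epatch_indic muleC.
Qed.

End density.

Section null_set.
Context d (T : measurableType d) (R : realType).
Variable m : {measure set T -> \bar R}.
Import HBNNSimple.

Let ge0_integral_null_set (N : set T) (g : T -> \bar R) :
  measurable N -> m N = 0 -> (forall x, 0 <= g x) ->
  \int[m]_x g x = \int[m]_(x in ~` N) g x.
Proof.
move=> mN N0 g0; apply/eqP; rewrite eq_le; apply/andP; split; last first.
  rewrite integral_mkcond !ge0_integralTE//; last first.
    by move=> x; rewrite erestrict_ge0.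
  apply: ereal_sup_le => _ [h hg <-]; exists h => // x; apply: (le_trans (hg x)).
  by rewrite patchE; case: ifPn.
rewrite ge0_integralTE// ge0_integralE//.
apply: ge_ereal_sup => _ [h /= hg <-].
pose h' := mul_nnsfun h (indic_nnsfun R (measurableC mN)).
apply: ereal_sup_ubound; exists h' => /=.
  move=> x; rewrite patchE /h' /= mindicE; case: ifPn => xN.
    by rewrite mulr1.
  by rewrite mulr0.
rewrite -!integralT_nnsfun.
rewrite [RHS](@ge0_negligible_integral _ _ _ m setT N)//; last 2 first.
  by apply/measurable_EFinP.
  by move=> x _; rewrite lee_fin.
rewrite [LHS](@ge0_negligible_integral _ _ _ m setT N)//; last 2 first.
  by apply/measurable_EFinP.
  by move=> x _; rewrite lee_fin.
apply: eq_integral => x /[!inE] -[_ xN].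
by rewrite /h' /= mindicE mem_set//= mulr1.
Qed.

(** The integral of an arbitrary function is defined through the simple functions
    below it, and truncating these to the complement of [N] does not change their
    integrals; hence [g] may be any function. *)
Lemma integral_null_set (N : set T) (g : T -> \bar R) :
  measurable N -> m N = 0 -> \int[m]_x g x = \int[m]_(x in ~` N) g x.
Proof.
move=> mN N0; rewrite integralE [RHS]integralE.
by congr (_ - _); apply: ge0_integral_null_set.
Qed.

Lemma eq_integral_null_set (N : set T) (g h : T -> \bar R) :
  measurable N -> m N = 0 -> (forall x, ~ N x -> g x = h x) ->
  \int[m]_x g x = \int[m]_x h x.
Proof.
move=> mN N0 gh; rewrite (integral_null_set _ mN N0).
by rewrite [RHS](integral_null_set _ mN N0); apply: eq_integral => x /[!inE]/gh.
Qed.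

Lemma ge0_le_integral_nonmeasurable (D : set T) (g h : T -> \bar R) :
  (forall x, D x -> 0 <= g x) -> (forall x, D x -> g x <= h x) ->
  \int[m]_(x in D) g x <= \int[m]_(x in D) h x.
Proof.
move=> g0 gh; rewrite !ge0_integralE//; last first.
  by move=> x Dx; rewrite (le_trans (g0 x Dx))// gh.
apply: ereal_sup_le => _ [e /= eg <-]; exists e => //= x.
apply: (le_trans (eg x)); rewrite !patchE; case: ifPn => // /[!inE].
exact: gh.
Qed.

End null_set.

Section integral_esum.
Context d (T : measurableType d) (R : realType).
Variable m : {measure set T -> \bar R}.
Context (I : countType).

Lemma esum_countable (S : set I) (a : I -> \bar R) : (forall i, 0 <= a i) ->
  \esum_(i in S) a i =
  \sum_(n <oo) (if pickle_inv n is Some i then if i \in S then a i else 0 else 0).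
Proof.
move=> a0.
pose b n := if pickle_inv n is Some i then if i \in S then a i else 0 else 0.
have b0 n : 0 <= b n by rewrite /b; case: (@choice.pickle_inv I n) => // i; case: ifP.
rewrite -[RHS]/(\sum_(n <oo) b n) nneseries_esumT//.
rewrite (esumID (choice.pickle @` S))// setTI [X in _ + X]esum1 ?adde0; last first.
  move=> n [_ /= nS]; rewrite /b; case E : (pickle_inv n) => [i|//].
  case: ifPn => // /[!inE] Si; exfalso; apply: nS; exists i => //.
  by have := @pickle_invK I n; rewrite E /=.
rewrite esum_image; last by move=> i j _ _; exact: (pcan_inj (@choice.pickleK I)).
by apply: eq_esum => i Si; rewrite /b choice.pickleK_inv mem_set.
Qed.

Lemma ge0_integral_esum (D : set T) (S : set I) (g : I -> T -> \bar R) :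
  measurable D -> (forall i, measurable_fun D (g i)) ->
  (forall i x, D x -> 0 <= g i x) ->
  \int[m]_(x in D) (\esum_(i in S) g i x) =
  \esum_(i in S) \int[m]_(x in D) g i x.
Proof.
move=> mD mg g0; rewrite esum_countable; last first.
  by move=> i; apply: integral_ge0 => x; exact: g0.
under eq_integral.
  move=> x /[!inE] Dx; rewrite esum_countable; last by move=> i; exact: g0.
  over.
rewrite integral_nneseries//; last 2 first.
- by move=> n; case: (@choice.pickle_inv I n) => // i; case: (i \in S).
- by move=> n x Dx; case: (@choice.pickle_inv I n) => // i; case: (i \in S) => //; exact: g0.
apply: eq_eseriesr => n _; case: (@choice.pickle_inv I n) => [i|]; last exact: integral0.
by case: (i \in S) => //; exact: integral0.
Qed.

Lemma ge0_measurable_fun_esum (D : set T) (S : set I) (g : I -> T -> \bar R) :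
  (forall i, measurable_fun D (g i)) -> (forall i x, D x -> 0 <= g i x) ->
  measurable_fun D (fun x => \esum_(i in S) g i x).
Proof.
move=> mg g0.
apply: (eq_measurable_fun (fun x => \sum_(n <oo)
  (if @choice.pickle_inv I n is Some i then if i \in S then g i x else 0 else 0))).
  by move=> x /[!inE] Dx; rewrite esum_countable// => i; exact: g0.
apply: ge0_emeasurable_sum => n.
- by move=> x Dx _; case: (@choice.pickle_inv I n) => // i; case: (i \in S) => //; exact: g0.
- by case: (@choice.pickle_inv I n) => // i; case: (i \in S).
Qed.

End integral_esum.

Section measurable_ereal.
Context (R : realType).

Lemma measurable_fun_EFin (F : \bar R -> \bar R) :
  measurable_fun setT (F \o EFin) -> measurable_fun setT F.
Proof.
move=> mF; rewrite (_ : F = fun x => if x == +oo then F +oo else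
    if x == -oo then F -oo else (F \o EFin) (fine x)); last first.
  by apply/funext => -[r| |].
apply: measurable_fun_ifT => //; first exact: measurable_fun_eqe.
apply: measurable_fun_ifT => //; first exact: measurable_fun_eqe.
by apply: measurableT_comp => //; exact: fine_measurable.
Qed.

Lemma measurable_expeR : measurable_fun [set: \bar R] expeR.
Proof.
by apply: measurable_fun_EFin; apply/measurable_EFinP; exact: measurable_expR.
Qed.

(** On the positive reals the inverse is [expR (- ln r)]. *)
Lemma measurable_inve : measurable_fun [set: \bar R] inve.
Proof.
apply: measurable_fun_EFin.
rewrite (_ : _ \o _ = fun r : R => if r == 0%R then +oo else
    (if 0 <= r then expR (- ln r) else - expR (- ln (- r)))%:E); last first.
  apply/funext => r /=; rewrite inver; case: eqVneq => // r0; congr EFin.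
  case: (ltgtP 0%R r) r0 => // r0 _.
    by rewrite expRN lnK.
  by rewrite expRN lnK ?posrE ?oppr_gt0// invrN opprK.
apply: measurable_fun_ifT => //; first exact: measurable_fun_eqr.
apply/measurable_EFinP.
apply: measurable_fun_ifT => //; first exact: measurable_fun_ler.
  apply: measurableT_comp; first exact: measurable_expR.
  by apply: measurableT_comp => //; exact: measurable_ln.
apply: measurableT_comp => //.
apply: measurableT_comp; first exact: measurable_expR.
apply: measurableT_comp => //.
by apply: measurableT_comp => //; exact: measurable_ln.
Qed.

End measurable_ereal.

Section generator.
Context d1 d2 d (T1 : measurableType d1) (T2 : measurableType d2)
  (T : measurableType d) (R : realType).
Variables (m1 : {measure set T1 -> \bar R}) (m2 : {measure set T2 -> \bar R}).
Variables (phi : T1 -> T) (psi : T2 -> T) (G : set (set T)).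
Hypotheses (mphi : measurable_fun setT phi) (mpsi : measurable_fun setT psi).
Hypotheses (GE : measurable = <<s G >>) (GI : setI_closed G) (GT : G setT).
Hypothesis m12 : forall C, G C -> m1 (phi @^-1` C) = m2 (psi @^-1` C).
Hypothesis m1_fin : m1 setT < +oo.

Let phi_mfun : {mfun T1 >-> T} := HB.pack phi (isMeasurableFun.Build _ _ _ _ phi mphi).
Let psi_mfun : {mfun T2 >-> T} := HB.pack psi (isMeasurableFun.Build _ _ _ _ psi mpsi).

(** The form in which uniqueness of measures is used: the two images need to
    agree only on a generating class stable under intersection. *)
Lemma eq_integral_generator (g : T -> \bar R) :
  measurable_fun setT g -> (forall t, 0 <= g t) ->
  \int[m1]_x g (phi x) = \int[m2]_x g (psi x).
Proof.
move=> mg g0.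
transitivity (\int[pushforward m1 phi_mfun]_t g t).
  by rewrite ge0_integral_pushforward// preimage_setT.
transitivity (\int[pushforward m2 psi_mfun]_t g t); last first.
  by rewrite ge0_integral_pushforward// preimage_setT.
apply: eq_measure_integral => C mC _.
apply: (measure_unique G (fun=> setT)) => //; first by rewrite bigcup_const.
Qed.

End generator.

Lemma ge0_maxe0M (R : realType) (a b : \bar R) : 0 <= b ->
  maxe (a * b) 0 = maxe a 0 * b.
Proof.
move=> b0; have [a0|a0] := leP 0 a.
  by rewrite max_l// mule_ge0.
by rewrite mul0e max_r// mule_le0_ge0// ltW.
Qed.

(** * Unconditional convergence along exhaustions *)

Section exhaustion.
Context (R : realType) (T : choiceType).
Implicit Types (S : set T) (G : nat -> set T) (a : T -> \bar R).

(** Lattice boxes, boxes and translated boxes all cut out such sequences; as a finite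
    part of [S] is eventually included in [G n], sums of a constant sign over [G n]
    converge to the unordered sum over [S]. *)
Definition exhausts G S := [/\ forall n, finite_set (G n),
  forall n, G n `<=` S & forall p, S p -> \forall n \near \oo, G n p].

Lemma exhausts_sub G S F : exhausts G S -> finite_set F -> F `<=` S ->
  \forall n \near \oo, F `<=` G n.
Proof.
move=> [_ _ GS] /finite_seqP[s ->] sS.
have : {in s, forall p, \forall n \near \oo, G n p}.
  by move=> p ps; apply/GS/sS.
elim: s {sS} => [|p s ih] sG; first by apply: nearW.
have h1 := sG p (mem_head _ _).
have h2 : \forall n \near \oo, [set` s] `<=` G n.
  by apply: ih => q qs; apply: sG; rewrite inE qs orbT.
near=> n => q /=; rewrite inE => /orP[/eqP ->|].
  by near: n.
by move: q; near: n.
Unshelve. all: by end_near. Qed.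

Lemma exhausts_setI G S B : exhausts G S -> finite_set (S `&` B) ->
  \forall n \near \oo, G n `&` B = S `&` B.
Proof.
move=> GS fSB; have [_ GS1 _] := GS.
have h := exhausts_sub GS fSB (@subIsetl _ _ _).
near=> n; apply/seteqP; split=> [p [Gp Bp]|p SBp].
  by split => //; exact: (GS1 n).
by split; [move: p SBp; near: n|case: SBp].
Unshelve. all: by end_near. Qed.

Lemma cvg_from_below (u : nat -> \bar R) (l : \bar R) : (forall n, u n <= l) ->
  (forall c, c < l -> \forall n \near \oo, c < u n) -> u @ \oo --> l.
Proof.
move=> ul lu; case: l => [l| |] in ul lu *; last first.
- rewrite (_ : u = cst -oo); first exact: cvg_cst.
  by apply/funext => n; apply/eqP; rewrite -leeNy_eq.
- apply/cvgeyPge => c; apply: filterS (lu c%:E (ltry _)) => n; exact: ltW.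
apply/fine_cvgP; split.
  apply: filterS (lu -oo (ltNyr _)) => n un; rewrite fin_numElt un/=.
  by rewrite (le_lt_trans (ul n))// ltry.
apply/cvgrPdist_le => e e0.
have : (l - e)%:E < l%:E by rewrite lte_fin ltrBlDr ltrDl.
move=> /lu; apply: filterS => n /= + .
have := ul n; case: (u n) => [r| |]//=; rewrite lee_fin lte_fin => rl ler.
rewrite ger0_norm ?subr_ge0//; lra.
Qed.

Lemma exhausts_esum G S a : exhausts G S -> (forall p, S p -> 0 <= a p) ->
  (fun n => \sum_(p \in G n) a p) @ \oo --> \esum_(p in S) a p.
Proof.
move=> GS a0; have [Gf GS1 _] := GS; apply: cvg_from_below => [n|c].
  by apply: ereal_sup_ubound; exists (G n).
rewrite /esum => /ereal_sup_gt[_ [F [fF FS] <-] cF].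
have := exhausts_sub GS fF FS; apply: filterS => n FG.
apply: (lt_le_trans cF); apply: lee_fsum_nneg_subset => //.
  by move=> p /[!inE]; exact: FG.
by move=> p /[!inE]/= /andP[_ pG]; apply/a0/(GS1 n)/set_mem.
Qed.

(** Up to the finitely many terms in [r] the sum has a constant sign, so that its
    limit does not depend on the exhaustion. When a term in [r] is [+oo], the
    partial sums are eventually [+oo], whatever the other terms are. *)
Lemma exhausts_fsum_fin S a : (forall p, S p -> a p != -oo) ->
  forall r : set T, finite_set (S `&` r) ->
  ((forall p, S p -> ~ r p -> 0 <= a p) \/ (forall p, S p -> ~ r p -> a p <= 0)) ->
  exists l : \bar R, forall G, exhausts G S -> (fun n => \sum_(p \in G n) a p) @ \oo --> l.
Proof.
move=> aNy r fr sgn.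
have fsumNy (F : set T) : F `<=` S -> finite_set F -> \sum_(p \in F) a p != -oo.
  move=> FS fF; rewrite fsbig_finite//=; apply/eqP => /esum_eqNyP[p [+ _ /eqP]].
  by rewrite in_fset_set// inE => /FS /aNy /negPf ->.
have split_sum G' n : exhausts G' S -> \sum_(p \in G' n) a p =
    \sum_(p \in G' n `&` r) a p + \sum_(p \in G' n `&` ~` r) a p.
  by move=> [fG _ _]; rewrite (fsbigID r)//.
have exC G' : exhausts G' S -> exhausts (fun n => G' n `&` ~` r) (S `&` ~` r).
  move=> [fG GS1 GS2]; split=> [n|n|p [Sp rp]].
  - exact: finite_setIl.
  - by apply: setSI.
  - by apply: filterS (GS2 p Sp) => n Gp.
have [|fin0] := eqVneq (\sum_(p \in S `&` r) a p) +oo.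
  move=> infty; exists +oo => G' GS.
  apply: cvg_near_cst; have := exhausts_setI GS fr; apply: filterS => n Gr.
  rewrite split_sum// Gr infty addye//; apply: fsumNy.
    by case: GS => _ GS _ p [/GS].
  by case: GS => fG _ _; exact: finite_setIl.
have {}fin0 : \sum_(p \in S `&` r) a p \is a fin_num.
  by rewrite fin_numE fin0 fsumNy.
suff [l hl] : exists l : \bar R, forall G', exhausts G' S ->
    (fun n => \sum_(p \in G' n `&` ~` r) a p) @ \oo --> l.
  exists (\sum_(p \in S `&` r) a p + l) => G' GS.
  rewrite (_ : (fun n => _) = (fun n => \sum_(p \in G' n `&` r) a p +
      \sum_(p \in G' n `&` ~` r) a p)); last by apply/funext => n; exact: split_sum.
  apply: cvgeD; [exact: fin_num_adde_defr| |exact: hl].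
  apply: cvg_near_cst; have := exhausts_setI GS fr; apply: filterS => n -> //.
case: sgn => sgn.
  exists (\esum_(p in S `&` ~` r) a p) => G' /exC GS.
  by apply: exhausts_esum => // p [Sp rp]; exact: sgn.
exists (- \esum_(p in S `&` ~` r) (- a p)) => G' /exC GS.
rewrite (_ : (fun n => _) = (fun n => - \sum_(p \in G' n `&` ~` r) (- a p))).
  apply: cvgeN; apply: exhausts_esum => // p [Sp rp].
  by rewrite oppe_ge0; exact: sgn.
apply/funext => n; have [fG GS1 _] := GS.
rewrite !fsbig_finite//= big_seq [in RHS]big_seq -sumeN.
  by apply: eq_bigr => p _; rewrite oppeK.
move=> p q; rewrite ![_ \in in_mem^~ _]topredE !in_fset_set// !inE => /GS1[Sp rp] /GS1[Sq rq].
by apply: ge0_adde_def; rewrite !inE oppe_ge0; apply: sgn.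
Qed.

End exhaustion.

(** * Boxes, balls and locally finite sets *)

Section geometry.
Context (R : realType) (d : nat).
Local Notation E := 'rV[R]_d.
Implicit Types (x y : E) (g : pconf R d).

Lemma le_coord_enorm x i : (`|x ord0 i| <= enorm x)%R.
Proof.
rewrite -sqrtr_sqr ler_sqrt; last by apply: sumr_ge0 => j _; exact: sqr_ge0.
rewrite (bigD1 i)//= lerDl; apply: sumr_ge0 => j _; exact: sqr_ge0.
Qed.

Lemma enorm_ge0 x : (0 <= enorm x)%R.
Proof. exact: sqrtr_ge0. Qed.

Lemma enormN x : enorm (- x) = enorm x.
Proof.
by rewrite /enorm; congr Num.sqrt; apply: eq_bigr => i _; rewrite mxE sqrrN.
Qed.

Lemma enorm_eq0 x : enorm x = 0%R -> x = 0%R.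
Proof.
move=> x0; apply/rowP => i; rewrite mxE; apply/eqP.
by rewrite -normr_eq0 eq_le normr_ge0 andbT -x0 le_coord_enorm.
Qed.

Lemma subset_box m n : (m <= n)%N -> @box R d m `<=` box n.
Proof.
by move=> mn x xm i; rewrite (le_trans (xm i))// ler_nat.
Qed.

Lemma mem_box x : exists n, box n x.
Proof.
exists (Num.truncn (enorm x)).+1 => i.
by rewrite (le_trans (le_coord_enorm x i))// ltW// truncnS_gt.
Qed.

Lemma bounded_cball y r : bounded_rV (cball y r).
Proof.
exists (Num.truncn (enorm y + r)).+1 => x xr i.
rewrite (le_trans _ (ltW (truncnS_gt _)))//.
rewrite -(subrK (y ord0 i) (x ord0 i)) (le_trans (ler_normD _ _))//.
rewrite addrC lerD ?le_coord_enorm//.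
have := le_coord_enorm (x - y) i; rewrite !mxE => /le_trans; exact.
Qed.

Lemma bounded_rVD W v : bounded_rV W -> bounded_rV ((fun x : E => x + v)%R @` W).
Proof.
move=> [n Wn]; have [m vm] := mem_box v; exists (n + m)%N => _ [x Wx <-] i.
rewrite mxE natrD (le_trans (ler_normD _ _))//.
by apply: lerD; [exact: Wn|exact: vm].
Qed.

Lemma locally_finite_bounded g W : locally_finite g -> bounded_rV W ->
  finite_set ((g : set E) `&` W).
Proof.
by move=> gf [n Wn]; apply: sub_finite_set (gf n); exact: setIS.
Qed.

Lemma finite_locally_finite g : finite_set (g : set E) -> locally_finite g.
Proof. by move=> gf n; exact: finite_setIl. Qed.

Lemma sub_locally_finite (g g' : pconf R d) : (g : set E) `<=` g' ->
  locally_finite g' -> locally_finite g.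
Proof. by move=> gg' g'f n; apply: sub_finite_set (g'f n); exact: setSI. Qed.

Lemma locally_finite_translate g v : locally_finite g ->
  locally_finite (translate g v).
Proof.
move=> gf n.
have bv : bounded_rV ((fun x : E => x + - v)%R @` (box n)).
  by apply: bounded_rVD; exists n.
apply: (sub_finite_set _ (finite_image (fun x => x + v)%R
  (locally_finite_bounded gf bv))).
by move=> _ [[x gx <-] xv]; exists x => //; split => //; exists (x + v)%R => //; rewrite addrK.
Qed.

Lemma exhausts_box g : locally_finite g ->
  exhausts (fun n => (g : set E) `&` box n) g.
Proof.
move=> gf; split => [n|n p []//|p gp]; first exact: gf.
have [N pN] := mem_box p; exists N => // n /= Nn; split => //.
exact: subset_box pN.
Qed.

End geometry.

(** * Existence and invariance of the local energy *)

(** A monotone function either keeps its sign forever or changes it once. *)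
Lemma constant_sign_at_infinity (R : realType) (phi : R -> \bar R) :
  monotone_at_infinity phi -> exists r1 : R,
  (forall r, (r1 <= r)%R -> 0 <= phi r) \/ (forall r, (r1 <= r)%R -> phi r <= 0).
Proof.
move=> [r0 [mon|mon]].
- have [[r [r0r phir]]|neg] := pselect (exists r, (r0 <= r)%R /\ 0 <= phi r).
    by exists r; left => s rs; rewrite (le_trans phir)// mon.
  exists r0; right => r r0r; rewrite leNgt; apply/negP => /ltW phir.
  by apply: neg; exists r.
- have [[r [r0r phir]]|pos] := pselect (exists r, (r0 <= r)%R /\ phi r <= 0).
    by exists r; right => s rs; rewrite (le_trans _ phir)// mon.
  exists r0; left => r r0r; rewrite leNgt; apply/negP => /ltW phir.
  by apply: pos; exists r.
Qed.

Section energy.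
Context (R : realType) (d : nat) (H : pconf R d -> \bar R).
Local Notation E := 'rV[R]_d.
Hypotheses (H_ham : is_hamiltonian H) (H_hered : hereditary_hamiltonian H).

Lemma hamiltonian_Ny (g : pconf R d) : finite_set (g : set E) -> H g != -oo.
Proof. by case: H_ham => _; exact. Qed.

Lemma ediff_self (a : \bar R) : a != -oo -> ediff a a = 0.
Proof. by case: a => //= r _; rewrite /ediff /= subee. Qed.

Lemma hereditary_sub (g g' : pconf R d) : finite_set (g' : set E) ->
  (g : set E) `<=` g' -> H g = +oo -> H g' = +oo.
Proof.
move=> fg' gg' Hg; have fg := sub_finite_set gg' fg'.
have : finite_set ((g' : set E) `\` g) by exact: finite_setD.
move=> /finite_seqP[s sE].
have -> : g' = (g : set E) `|` [set` s] :> set E by rewrite -sE setDUK.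
elim: s {sE} => [|x s ih]; first by rewrite set_nil setU0.
rewrite (_ : _ `|` _ = ((g : set E) `|` [set` s]) `|` [set x]).
  by apply: H_hered => //; rewrite finite_setU.
apply/seteqP; split => y /=; rewrite inE.
  by move=> [gy|/orP[/eqP ->|ys]]; [left; left|right|left; right].
by move=> [[gy|->]|->]; [left|right; rewrite orbT|right; rewrite eqxx].
Qed.

Lemma ediff_cvg_mem (g : pconf R d) (y : E) (G : nat -> set E) : g y ->
  exhausts G g -> 
  (fun n => ediff (H ([set y] `|` G n)) (H (G n))) @ \oo --> (0 : \bar R).
Proof.
move=> gy [fG _ GS]; apply: cvg_near_cst; apply: filterS (GS y gy) => n Gy.
rewrite (_ : _ `|` _ = G n); first exact/ediff_self/hamiltonian_Ny.
by apply/setUidr => _ ->.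
Qed.

(** For a finite configuration the defining sequence is eventually constant, so
    that the finite range property becomes an identity between energies. *)
Lemma local_hamiltonian_finite (W : set E) (g : pconf R d) :
  finite_set (g : set E) ->
  local_hamiltonian H W g = ediff (H g) (H ((g : set E) `\` W)).
Proof.
move=> fg; apply: cvg_lim => //; apply: cvg_near_cst.
have := exhausts_sub (exhausts_box (finite_locally_finite fg)) fg (@subset_refl _ _).
apply: filterS => n gn; congr (ediff (H _) (H _)).
  by apply/seteqP; split => p; [case|exact: gn].
by apply/seteqP; split => p [gp]; [case|move=> Wp; split => //; split => //; case: (gn p gp)].
Qed.

(** Applied to [W = {y}] and to the finite configurations [{y} U G n], the finite
    range property shows that the difference depends only on the points of [G n]
    in a ball around [y], and these are eventually those of [g]. *)
Lemma finite_range_cvg (g : pconf R d) (y : E) : finite_range H ->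
  locally_finite g -> ~ g y -> exists l : \bar R, forall G : nat -> set E,
  exhausts G g -> (fun n => ediff (H ([set y] `|` G n)) (H (G n))) @ \oo --> l.
Proof.
move=> [r r0 Hr] gf gy; pose V : set E := thicken [set y] r.
have y_bnd : bounded_rV [set y] by have [n yn] := mem_box y; exists n => _ ->.
have Vy : V y.
  exists y => //; exists 0%R; last by rewrite addr0.
  by rewrite /cball /= subrr /enorm big1 ?sqrtr0 ?ltW// => i _; rewrite mxE expr0n.
have V_bnd : bounded_rV V.
  have [n yn] := bounded_cball y r; exists n => _ [_ -> [z zr <-]]; apply: yn.
  by move: zr; rewrite /cball /= subr0 addrAC subrr add0r.
exists (ediff (H ([set y] `|` ((g : set E) `&` V))) (H ((g : set E) `&` V))) => G Gg.
apply: cvg_near_cst.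
have := exhausts_setI Gg (locally_finite_bounded gf V_bnd).
apply: filterS => n Gn; have [fG Ggs _] := Gg.
have Gy : ~ G n y by move=> /Ggs.
have fyG : finite_set ([set y] `|` G n) by rewrite finite_setU; split.
have rem (B : set E) : ~ B y -> ([set y] `|` B) `\` [set y] = B.
  move=> By; apply/seteqP; split => p; first by move=> [[//|]].
  by move=> Bp; split; [right|move=> py; apply: By; rewrite -py].
have := Hr [set y] _ y_bnd (finite_locally_finite fyG).
rewrite !local_hamiltonian_finite//; last exact: finite_setIl.
rewrite rem// -/V setIUl Gn (_ : [set y] `&` V = [set y]); last first.
  by apply/setIidl => _ ->.
by rewrite rem//; case.
Qed.

Lemma pairwise_setU1 (phi : R -> \bar R) (y : E) (F : set E) :
  (forall s : seq E, uniq s ->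
     H [set` s] = \sum_(i < size s) \sum_(j < size s | (i < j)%N)
       phi (enorm (nth 0%R s i - nth 0%R s j))) ->
  finite_set F -> ~ F y ->
  H ([set y] `|` F) = \sum_(p \in F) phi (enorm (y - p)%R) + H F.
Proof.
move=> Hphi fF Fy.
have [s us FE] : exists2 s : seq E, uniq s & F = [set` s].
  exists (fset_set F); first exact: fset_uniq.
  by apply/seteqP; split => p /=; rewrite in_fset_set// inE.
have ys : y \notin s by apply/negP => ys; apply: Fy; rewrite FE.
rewrite FE (_ : _ `|` _ = [set` y :: s]); last first.
  apply/seteqP; split => p /=; rewrite inE; first by move=> [->|->]; rewrite ?eqxx ?orbT.
  by move=> /orP[/eqP ->|ps]; [left|right].
rewrite !Hphi//=; last by rewrite ys.
rewrite big_ord_recl; congr (_ + _).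
  rewrite big_mkcond big_ord_recl/= add0e -fsbig_seq// (big_nth 0%R) big_mkord.
  by apply: eq_bigr.
apply: eq_bigr => i _; rewrite big_mkcond big_ord_recl/= add0e [RHS]big_mkcond.
by apply: eq_bigr.
Qed.

(** The difference is the interaction of [y] with [G n], unless some finite part
    of [g] has infinite energy; by heredity both energies are then eventually
    infinite and their difference is zero by convention. *)
Lemma pairwise_cvg (g : pconf R d) (y : E) : summable_pairwise H ->
  locally_finite g -> ~ g y -> exists l : \bar R, forall G : nat -> set E,
  exhausts G g -> (fun n => ediff (H ([set y] `|` G n)) (H (G n))) @ \oo --> l.
Proof.
move=> [phi [_ [phiNy phi_mon Hphi _ _]]] gf gy.
have [[F [fF Fg HF]]|Hfin] := pselect (exists F : set E,
    [/\ finite_set F, F `<=` g & H F = +oo]).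
  exists 0 => G Gg; have [fG Ggs _] := Gg.
  apply: cvg_near_cst; apply: filterS (exhausts_sub Gg fF Fg) => n FG.
  have HG := hereditary_sub (fG n) FG HF.
  have fyG : finite_set ([set y] `|` G n) by rewrite finite_setU; split.
  by rewrite /ediff HG (hereditary_sub fyG _ HG)//; right.
have [r1 sgn] := constant_sign_at_infinity phi_mon.
pose a p := phi (enorm (y - p)%R).
have aNy p : g p -> a p != -oo.
  move=> gp; apply: phiNy; rewrite lt_neqAle enorm_ge0 andbT eq_sym.
  apply/eqP => /enorm_eq0 /eqP; rewrite subr_eq0 => /eqP yp.
  by apply: gy; rewrite yp.
have fr := locally_finite_bounded gf (bounded_cball y r1).
have sgn' : (forall p, g p -> ~ cball y r1 p -> 0 <= a p) \/
            (forall p, g p -> ~ cball y r1 p -> a p <= 0).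
  have far p : ~ cball y r1 p -> (r1 <= enorm (y - p)%R)%R.
    move=> /negP; rewrite -ltNge => /ltW.
    by rewrite -opprB enormN.
  by case: sgn => sgn; [left|right] => p gp /far; exact: sgn.
have [l hl] := exhausts_fsum_fin aNy fr sgn'.
exists l => G Gg; have [fG Ggs _] := Gg.
rewrite (_ : (fun n => _) = (fun n => \sum_(p \in G n) a p)); first exact: hl.
apply/funext => n.
have GnNy : H (G n) != +oo by apply/eqP => HG; apply: Hfin; exists (G n).
rewrite /ediff (negPf GnNy) andbF (pairwise_setU1 Hphi)//; last by move=> /Ggs.
by rewrite addeK// fin_numE GnNy hamiltonian_Ny.
Qed.

Hypothesis H_case : finite_range H \/ summable_pairwise H.

(** The limit [l] does not depend on [G]: this is what identifies the energies
    defined along different exhaustions. *)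
Lemma energy_cvg (g : pconf R d) (y : E) : locally_finite g ->
  exists l : \bar R, forall G : nat -> set E,
  exhausts G g -> (fun n => ediff (H ([set y] `|` G n)) (H (G n))) @ \oo --> l.
Proof.
move=> gf; have [gy|gy] := pselect (g y).
  by exists 0 => G; exact: ediff_cvg_mem.
by case: H_case => Hc; [exact: finite_range_cvg|exact: pairwise_cvg].
Qed.

Lemma local_energy_cvg (g : pconf R d) (y : E) (G : nat -> set E) :
  locally_finite g -> exhausts G g ->
  (fun n => ediff (H ([set y] `|` G n)) (H (G n))) @ \oo --> local_energy H y g.
Proof.
move=> gf Gg; have [l hl] := energy_cvg y gf.
rewrite /local_energy (_ : limn _ = l); first exact: hl.
by apply: cvg_lim => //; apply: hl; exact: exhausts_box.
Qed.

(** Translating back, the boxes become translated boxes, which form another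
    exhaustion of [g]. *)
Lemma local_energy_translate (g : pconf R d) (y v : E) : translation_invariant H ->
  locally_finite g -> local_energy H (y + v)%R (translate g v) = local_energy H y g.
Proof.
move=> H_transl gf; apply: cvg_lim => //.
pose G n : set E := [set p | g p /\ box n (p + v)%R].
have Gg : exhausts G g.
  split=> [n|n p []//|p gp].
    have bv : bounded_rV ((fun x : E => x + - v)%R @` (box n)).
      by apply: bounded_rVD; exists n.
    apply: sub_finite_set (locally_finite_bounded gf bv).
    by move=> p [gp pv]; split => //; exists (p + v)%R => //; rewrite addrK.
  have [N pN] := mem_box (p + v)%R; exists N => // n /= Nn; split => //.
  exact: subset_box pN.
have [fG _ _] := Gg.
have GE n : (translate g v : set E) `&` box n = translate (G n) v.
  apply/seteqP; split => [_ [[p gp <-] pn]|_ [p [gp pn] <-]]; first by exists p.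
  by split => //; exists p.
rewrite (_ : (fun n => _) = (fun n => ediff (H ([set y] `|` G n)) (H (G n)))).
  exact: local_energy_cvg.
apply/funext => n; rewrite GE; congr ediff; last exact: H_transl.
rewrite -(H_transl ([set y] `|` G n) v); last by rewrite finite_setU; split.
congr H; apply/seteqP; split => [_ [->|[p Gp <-]]|_ [p [->|Gp] <-]].
- by exists y => //; left.
- by exists p => //; right.
- by left.
- by right; exists p.
Qed.

End energy.

(** * Measurability in R^d and of point configurations *)

Section countable_operations.
Context dd (T : measurableType dd) (I : countType).

Lemma countable_bigcupE (D : set I) (F : I -> set T) :
  \bigcup_(i in D) F i = \bigcup_(n : nat)
  (if @choice.unpickle I n is Some i then if i \in D then F i else set0 else set0).
Proof.
apply/seteqP; split => [x [i Di Fi]|x [n _]].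
  by exists (choice.pickle i) => //; rewrite choice.pickleK mem_set.
by case: choice.unpickle => // i; case: ifPn => // /[!inE] Di Fi; exists i.
Qed.

Lemma countable_bigcup_measurable (D : set I) (F : I -> set T) :
  (forall i, D i -> measurable (F i)) -> measurable (\bigcup_(i in D) F i).
Proof.
move=> mF; rewrite countable_bigcupE.
apply: bigcupT_measurable => n; case: choice.unpickle => // i.
by case: ifPn => // /[!inE]; exact: mF.
Qed.

Lemma countable_bigcup_negligible (R : realType) (m : {measure set T -> \bar R})
    (D : set I) (F : I -> set T) :
  (forall i, D i -> m.-negligible (F i)) -> m.-negligible (\bigcup_(i in D) F i).
Proof.
move=> F0; rewrite countable_bigcupE; apply: negligible_bigcup => n.
case: choice.unpickle => [i|]; last exact: negligible_set0.
by case: ifPn => [/[!inE]/F0//|_]; exact: negligible_set0.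
Qed.

Lemma countable_bigcap_measurable (D : set I) (F : I -> set T) :
  (forall i, D i -> measurable (F i)) -> measurable (\bigcap_(i in D) F i).
Proof.
move=> mF; rewrite -(setCK (\bigcap_(i in D) F i)) setC_bigcap.
apply: measurableC; apply: countable_bigcup_measurable => i Di.
by apply: measurableC; exact: mF.
Qed.

End countable_operations.

Section measurable_vectors.
Context (R : realType) (d : nat).
Local Notation E := 'rV[R]_d.

Lemma measurable_coord (i : 'I_d) : measurable_fun [set: E] (fun x : E => x ord0 i).
Proof.
move=> _ B mB; rewrite setTI; apply: sub_sigma_algebra.
rewrite -bigcup_seq; exists i; first by rewrite /= mem_index_enum.
by exists B => //; rewrite setTI.
Qed.

Lemma measurable_fun_rV d1 (T : measurableType d1) (D : set T) (p : T -> E) :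
  (forall i, measurable_fun D (fun t => p t ord0 i)) -> measurable_fun D p.
Proof.
move=> mp mD; apply: (@measurability _ _ _ _ _ _ (\big[setU/set0]_(i < d)
  preimage_set_system setT (fun x : E => x ord0 i) measurable)) => //.
move=> _ [C + <-]; rewrite -bigcup_seq => -[i _ [B mB <-]].
by rewrite setTI; exact: mp.
Qed.

Lemma measurable_rVD d1 (T : measurableType d1) (D : set T) (p r : T -> E) :
  measurable_fun D p -> measurable_fun D r -> measurable_fun D (fun t => p t + r t)%R.
Proof.
move=> mp mr; apply: measurable_fun_rV => i; under eq_fun do rewrite mxE.
by apply: measurable_funD; apply: (measurableT_comp (measurable_coord i)).
Qed.

Lemma measurable_eq_rV d1 (T : measurableType d1) (p r : T -> E) :
  measurable_fun setT p -> measurable_fun setT r -> measurable [set t | p t = r t].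
Proof.
move=> mp mr.
rewrite (_ : [set t | _] = \bigcap_(i in [set: 'I_d])
  [set t | p t ord0 i = r t ord0 i]); last first.
  apply/seteqP; split => [t /= pr i _ /=|t pr]; first by rewrite pr.
  by apply/rowP => i; exact: pr.
apply: countable_bigcap_measurable => i _.
rewrite (_ : [set t | _] = (fun t => p t ord0 i == r t ord0 i) @^-1` [set true]).
  rewrite -[X in measurable X]setTI; apply: measurable_fun_eqr => //;
    exact: measurableT_comp (measurable_coord i) _.
by apply/seteqP; split => t /= /eqP.
Qed.

Lemma measurable_set1_rV (x : E) : measurable [set x].
Proof. exact: (@measurable_eq_rV _ _ id (cst x)). Qed.

Lemma measurable_box n : measurable (@box R d n).
Proof.
rewrite (_ : box n = \bigcap_(i in [set: 'I_d])
   ((fun x : E => `|x ord0 i|%R) @^-1` [set r | (r <= n%:R)%R])); last first.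
  by apply/seteqP; split => [x xn i _|x xn i]; exact: xn.
apply: countable_bigcap_measurable => i _.
have mf : measurable_fun [set: E] (fun x : E => `|x ord0 i|%R).
  by apply: measurableT_comp => //; exact: measurable_coord.
rewrite -[X in measurable X]setTI; apply: mf => //.
rewrite (_ : [set r | _] = [set` `]-oo, (n%:R : R)]]); first exact: measurable_itv.
by apply/seteqP; split => r /=; rewrite in_itv.
Qed.

Lemma measurable_enorm : measurable_fun [set: E] (@enorm R d).
Proof.
apply: (measurableT_comp (continuous_measurable_fun (@sqrt_continuous R))).
apply: measurable_sum => i; apply: measurable_funX; exact: measurable_coord.
Qed.

End measurable_vectors.

Section measurable_point_configurations.
Context (R : realType) (d : nat).
Local Notation E := 'rV[R]_d.

Lemma measurable_counting (W : set E) n : bounded_rV W -> measurable W ->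
  measurable [set g : pconf R d | ((g : set E) `&` W #= `I_n)%card].
Proof.
by move=> bW mW; apply: sub_sigma_algebra; exists W, n.
Qed.

Lemma bounded_box n : bounded_rV (@box R d n).
Proof. by exists n. Qed.

Lemma measurable_locally_finite : measurable (@locally_finite R d).
Proof.
rewrite (_ : locally_finite = \bigcap_(n : nat) \bigcup_(k : nat)
   [set g : pconf R d | ((g : set E) `&` box n #= `I_k)%card]).
  apply: countable_bigcap_measurable => n _.
  apply: countable_bigcup_measurable => k _.
  by apply: measurable_counting; [exact: bounded_box|exact: measurable_box].
apply/seteqP; split => [g gf n _|g gf n].
  by have [k gk] := gf n; exists k.
by have [k _ gk] := gf n Logic.I; exists k.
Qed.

(** A set is finite when it is locally finite and bounded, and boundedness is the
    vanishing of counting variables. *)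
Lemma measurable_finite : measurable [set g : pconf R d | finite_set (g : set E)].
Proof.
rewrite (_ : [set g | _] = locally_finite `&` \bigcup_(N : nat) \bigcap_(n : nat)
   [set g : pconf R d | ((g : set E) `&` (box n `\` box N) #= `I_0)%card]).
  apply: measurableI; first exact: measurable_locally_finite.
  apply: countable_bigcup_measurable => N _.
  apply: countable_bigcap_measurable => n _; apply: measurable_counting.
    by exists n => x [].
  by apply: measurableD; exact: measurable_box.
apply/seteqP; split => [g /= gf|g [gf [N _ gN]] /=].
  split; first exact: finite_locally_finite.
  have [N _ hN] := exhausts_sub (exhausts_box (finite_locally_finite gf)) gf (@subset_refl _ _).
  exists N => // n _ /=; rewrite II0 card_eq0; apply/eqP/seteqP; split => // x [gx [_]].
  by apply; have [] := hN N (leqnn N) x gx.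
apply: sub_finite_set (gf N) => x gx; split => //; apply: contrapT => xN.
have [n xn] := mem_box x; have := gN n Logic.I; rewrite /= II0 card_eq0 => /eqP.
by move=> /seteqP[/(_ x) + _]; apply.
Qed.

Context dd (T : measurableType dd) (I : countType).
Variables (p : I -> T -> E) (S : I -> set T).
Hypotheses (mp : forall i, measurable_fun setT (p i)) (mS : forall i, measurable (S i)).

(** The configuration of the points of a random countable family, each [p i] being
    present only on the event [S i]; several indices may give the same point. *)
Definition points (t : T) : pconf R d := [set p i t | i in [set i | S i t]].

(** As configurations are sets, the number of points in [W] is the number of
    indices that are first among those of their point, and the events that an
    index is first are measurable. *)
Lemma measurable_points : measurable_fun setT points.
Proof.
apply: measurability; first reflexivity.
move=> _ [_ [W [n [bW mW ->]] <-]]; rewrite setTI.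
have mpW i : measurable (p i @^-1` W) by rewrite -[X in measurable X]setTI; exact: mp.
(* the indices that are first, in the enumeration of I, among those of their point *)
pose L t : set I := [set i | [/\ S i t, W (p i t) & forall j,
  (choice.pickle j < choice.pickle i)%N -> S j t -> p j t <> p i t]].
have mL i : measurable [set t | L t i].
  rewrite (_ : [set t | _] = S i `&` (p i @^-1` W `&`
      \bigcap_(j in [set j | (choice.pickle j < choice.pickle i)%N])
         (~` (S j `&` [set t | p j t = p i t])))); last first.
    apply/seteqP; split => [t [Si Wi Lt]|t [Si [Wi Lt]]].
      by split => //; split => // j ji [Sj]; exact: Lt.
    by split => // j ji Sj pji; exact: (Lt j ji).
  apply: measurableI => //; apply: measurableI => //.
  apply: countable_bigcap_measurable => j _; apply/measurableC/measurableI => //.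
  exact: measurable_eq_rV.
have LE t : ((points t : set E) `&` W = p^~ t @` L t).
  apply/seteqP; split => [_ [[i /= Si <-] Wi]|_ [i [Si Wi _] <-]]; last first.
    by split => //; exists i.
  pose P m := `[< exists j, [/\ choice.pickle j = m, S j t & p j t = p i t] >].
  have exP : exists m, P m by exists (choice.pickle i); apply/asboolP; exists i.
  case: (ex_minnP exP) => m /asboolP[j [jm Sj pji]] min_m.
  exists j => //; split => //; first by rewrite pji.
  move=> k kj Sk pkj; have : P (choice.pickle k).
    by apply/asboolP; exists k; split => //; rewrite pkj.
  by move=> /min_m; rewrite -jm leqNgt kj.
have LI t : {in L t &, injective (p^~ t)}.
  move=> i j /[!inE] -[Si Wi Li] [Sj Wj Lj] pij.
  have [ij|ji|/(pcan_inj (@choice.pickleK I))//] :=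
    ltngtP (choice.pickle i) (choice.pickle j).
    by exfalso; exact: (Lj i).
  by exfalso; apply: (Li j ji Sj).
have cardL t : ((points t : set E) `&` W #= L t)%card.
  rewrite LE; exact: inj_card_eq (LI t).
rewrite (_ : _ @^-1` _ = [set t | (L t #= `I_n)%card]); last first.
  apply/seteqP; split => t /=; apply: card_eq_trans => //.
    by rewrite card_eq_sym.
rewrite (_ : [set t | _] = \bigcup_(F in [set F : {fset I} | #|` F| = n])
   \bigcap_(i : I) [set t | L t i <-> i \in F]); last first.
  apply/seteqP; split => [t /= Lt|t [F /= Fn LF]].
    have fL : finite_set (L t) by exists n.
    exists (fset_set (L t)); first exact: card_fset_set.
    by move=> i _ /=; rewrite in_fset_set// inE.
  rewrite (_ : L t = [set` F]); first exact/card_eq_fsetP.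
  by apply/seteqP; split => i /=; have := LF i Logic.I; rewrite /= => -[].
apply: countable_bigcup_measurable => F _.
apply: countable_bigcap_measurable => i _.
case: (boolP (i \in F)) => iF.
  by rewrite (_ : [set t | _] = [set t | L t i])//; apply/seteqP; split => t /=; [case=> _; exact|split].
rewrite (_ : [set t | _] = ~` [set t | L t i]); first exact: measurableC.
apply/seteqP; split => t /=; first by move=> [Lt _] /Lt; exact/negP.
by move=> Lti; split => //; rewrite (negPf iF).
Qed.

End measurable_point_configurations.

(** * Perturbed lattices and their site energies *)

Section lattice_configurations.
Context (R : realType) (d : nat) (A : 'M[R]_d).
Local Notation E := 'rV[R]_d.
Local Notation config := (config R d).
Local Notation pconf := (pconf R d).
Implicit Types (k j : 'rV[int]_d) (x : config) (y v : E) (S : set 'rV[int]_d).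

Lemma latptD k j : latpt A (k + j) = (latpt A k + latpt A j)%R.
Proof. by rewrite /latpt map_mxD mulmxDl. Qed.

Lemma latptB k j : latpt A (k - j) = (latpt A k - latpt A j)%R.
Proof. by rewrite /latpt map_mxB mulmxBl. Qed.

Lemma finite_Lam n : A \in unitmx -> finite_set (Lam A n).
Proof.
move=> A_basis.
pose M := (\sum_(l < d) \sum_(i < d) n%:R * `|invmx A l i|)%R.
pose N := (Num.truncn M).+1.
have bnd k (i : 'I_d) : Lam A n k -> (`|k ord0 i| <= N)%N.
  move=> kn; rewrite -(ler_nat R); apply: (@le_trans _ _ M); last exact/ltW/truncnS_gt.
  have -> : (`|k ord0 i|%N%:R = `|\sum_l latpt A k ord0 l * invmx A l i| :> R)%R.
    transitivity (`|(map_mx intr k : E) ord0 i|)%R.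
      by rewrite mxE -intr_norm -natr_absz.
    by rewrite -[map_mx intr k](mulmxK A_basis) mxE.
  rewrite (le_trans (ler_norm_sum _ _ _))//; apply: ler_sum => l _.
  rewrite normrM; apply: (@le_trans _ _ (n%:R * `|invmx A l i|)%R).
    by apply: ler_wpM2r => //; exact: kn.
  by rewrite (bigD1 i)//= lerDl; apply: sumr_ge0 => i' _; rewrite mulr_ge0.
pose g (m : 'M['I_(N + N).+1]_(1, d)) : 'rV[int]_d := map_mx (fun c : 'I_(N + N).+1 => (c%:Z - N%:Z)%R) m.
apply: (@sub_finite_set _ _ [set g m | m in setT]); last exact: finite_image.
move=> k kn; exists (\row_i inord (absz (k ord0 i + N%:Z)%R)) => //.
have cN (c : int) : (absz c <= N)%N -> (absz (c + N%:Z)%R < (N + N).+1)%N /\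
    ((absz (c + N%:Z)%R)%:Z - N%:Z)%R = c by clear; lia.
by apply/rowP => i; have [lt eq] := cN _ (bnd k i kn); rewrite !mxE inordK.
Qed.

Lemma Lam_eventually k : \forall n \near \oo, Lam A n k.
Proof.
have [N kN] := mem_box (latpt A k); exists N => // n /= Nn.
exact: subset_box kN.
Qed.

(** Stated at the translation 0, but invariant under translations of the points
    and under changes of finitely many perturbations. *)
Definition config_lf : set config := [set x | locally_finite (Gam A setT x 0%R)].

Lemma Gam_translate S x v : Gam A S x v = translate (Gam A S x 0%R) v.
Proof.
apply/seteqP; split => [_ [k Sk <-]|_ [_ [k Sk <-] <-]].
  by exists (latpt A k + x k)%R => //; exists k => //; rewrite addr0.
by exists k => //; rewrite addr0.
Qed.

Lemma Gam_locally_finite S x v : config_lf x -> locally_finite (Gam A S x v).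
Proof.
move=> xf; rewrite Gam_translate; apply: locally_finite_translate.
by apply: sub_locally_finite xf => _ [k _ <-]; exists k.
Qed.

Lemma Gam_setU1 S k x : S k ->
  Gam A S x 0%R = [set (latpt A k + x k)%R] `|` Gam A (S `\ k) x 0%R.
Proof.
move=> Sk; apply/seteqP; split => [_ [j Sj <-]|_ [->|[j [Sj _] <-]]].
- have [->|jk] := eqVneq j k; first by left; rewrite addr0.
  by right; exists j => //; split => //; apply/eqP.
- by exists k => //; rewrite addr0.
- by exists j.
Qed.

Definition update k y x : config := fun j => if j == k then y else x j.

Lemma update_id k x : update k (x k) x = x.
Proof. by apply/funext => j; rewrite /update; case: eqVneq => // ->. Qed.

Lemma update_update k y y' x : update k y (update k y' x) = update k y x.
Proof. by apply/funext => j; rewrite /update; case: eqVneq. Qed.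

Lemma Gam_update k y x v : Gam A (~` [set k]) (update k y x) v = Gam A (~` [set k]) x v.
Proof.
by apply/seteqP; split => _ [j jk <-]; exists j => //; rewrite /update; case: eqVneq jk.
Qed.

Lemma config_lf_update k y x : config_lf x -> config_lf (update k y x).
Proof.
move=> xf; rewrite /config_lf /= (@Gam_setU1 _ k)// setTD Gam_update => n.
rewrite setIUl finite_setU; split; first exact: finite_setIl.
exact: Gam_locally_finite.
Qed.

Lemma config_lf_updateE k y x : config_lf (update k y x) = config_lf x.
Proof.
apply/propext; split; last exact: config_lf_update.
by move=> /(config_lf_update k (x k)); rewrite update_update update_id.
Qed.

Lemma exhausts_Gam k x : A \in unitmx ->
  exhausts (fun n => Gam A (Lam A n `\ k) x 0%R) (Gam A (~` [set k]) x 0%R).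
Proof.
move=> A_basis; split => [n|n _ [j [_ jk] <-]|_ [j jk <-]].
- by apply: finite_image; apply: sub_finite_set (finite_Lam n A_basis) => j [].
- by exists j.
- by apply: filterS (Lam_eventually j) => n jn; exists j.
Qed.

End lattice_configurations.

Section measurable_configurations.
Context (R : realType) (d : nat) (A : 'M[R]_d).
Local Notation E := 'rV[R]_d.
Local Notation config := (config R d).
Local Notation pconf := (pconf R d).

Lemma measurable_coord_config k : measurable_fun [set: config] (fun x : config => x k).
Proof.
move=> _ B mB; rewrite setTI; apply: sub_sigma_algebra.
by exists k, B.
Qed.

Lemma measurable_fun_config dd (T : measurableType dd) (D : set T) (c : T -> config) :
  (forall k, measurable_fun D (fun t => c t k)) -> measurable_fun D c.
Proof.
move=> mc mD; apply: measurability => //.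
by move=> _ [_ [k [B [_ mB ->]]] <-]; exact: mc.
Qed.

Lemma measurable_shift_config j : measurable_fun setT (@shift_config R d j).
Proof. by apply: measurable_fun_config => k; exact: measurable_coord_config. Qed.

Lemma measurable_Gam S v : measurable_fun setT (fun x : config => Gam A S x v).
Proof.
pose p (k : 'rV[int]_d) (x : config) := (latpt A k + x k + v)%R.
rewrite (_ : (fun x => _) = points p (fun k => [set x : config | S k])).
  apply: measurable_points => k.
    by do 2 (apply: measurable_rVD => //); exact: measurable_coord_config.
  by have [Sk|Sk] := pselect (S k); [rewrite (_ : [set _ | _] = setT)//|
    rewrite (_ : [set _ | _] = set0)//]; apply/seteqP; split.
by [].
Qed.

Lemma measurable_config_lf : measurable (config_lf A).
Proof.
rewrite -[X in measurable X]setTI; apply: measurable_Gam => //.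
exact: measurable_locally_finite.
Qed.

End measurable_configurations.

Section measurable_energy.
Context (R : realType) (d : nat) (A : 'M[R]_d) (H : pconf R d -> \bar R).
Local Notation E := 'rV[R]_d.
Local Notation config := (config R d).
Local Notation pconf := (pconf R d).
Hypotheses (H_ham : is_hamiltonian H) (H_hered : hereditary_hamiltonian H).
Hypothesis H_case : finite_range H \/ summable_pairwise H.

Lemma measurable_ediff dd (T : measurableType dd) (D : set T) (f g : T -> \bar R) :
  measurable D -> measurable_fun D f -> measurable_fun D g ->
  measurable_fun D (fun t => ediff (f t) (g t)).
Proof.
move=> mD mf mg; apply: measurable_fun_if => //.
- by apply: measurable_and; exact: measurable_fun_eqe.
- have mb : measurable_fun D (fun t => (f t == +oo) && (g t == +oo)).
    by apply: measurable_and; exact: measurable_fun_eqe.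
  apply: (measurable_funS mD); first exact: subIsetl.
  exact: emeasurable_funB.
Qed.

(** The local energy of the [k]-th point when its perturbation is [p.1] and the
    others are those of [p.2]; it does not depend on [p.2 k]. *)
Definition site_energy (k : 'rV[int]_d) (p : E * config) : \bar R :=
  local_energy H (latpt A k + p.1)%R (Gam A (~` [set k]) p.2 0%R).

Definition lf_domain : set (E * config) := [set p | config_lf A p.2].

Lemma measurable_lf_domain : measurable lf_domain.
Proof.
rewrite (_ : lf_domain = setT `*` config_lf A); last first.
  by apply/seteqP; split => [p ?|p []].
by apply: measurableX => //; exact: measurable_config_lf.
Qed.

(** A pointwise limit of energies of finite configurations, each of which is a
    random set of points of the form [points]. *)
Lemma measurable_site_energy k : measurable_fun lf_domain (site_energy k).
Proof.
have mlf := measurable_lf_domain.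
pose g (p : E * config) := Gam A (~` [set k]) p.2 0%R.
apply: (emeasurable_fun_cvg (fun n p => ediff
  (H ([set (latpt A k + p.1)%R] `|` ((g p : set E) `&` box n))) (H ((g p : set E) `&` box n)))); last first.
  move=> p pf; apply: local_energy_cvg => //; first exact: Gam_locally_finite.
  by apply: exhausts_box; exact: Gam_locally_finite.
move=> n.
pose pt (j : 'rV[int]_d) (p : E * config) :=
  if j == k then (latpt A k + p.1)%R else (latpt A j + p.2 j + 0)%R.
have mpt j : measurable_fun setT (pt j).
  rewrite /pt; case: eqP => _.
    by apply: measurable_rVD => //; exact: measurable_fst.
  apply: measurable_rVD => //; apply: measurable_rVD => //.
  exact: measurableT_comp (measurable_coord_config j) measurable_snd.
pose inbox (j : 'rV[int]_d) := (pt j) @^-1` (box n).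
have minbox j : measurable (inbox j).
  by rewrite -[X in measurable X]setTI; apply: mpt => //; exact: measurable_box.
have gE p : (g p : set E) `&` box n = points pt (fun j => if j == k then set0 else inbox j) p.
  apply/seteqP; split => [_ [[j /= /eqP jk <-] jn]|_ [j + <-]] /=.
    by exists j; rewrite /= /inbox /pt (negPf jk).
  have [->|jk] := eqVneq j k; first by rewrite /= eqxx.
  rewrite /= (negPf jk) /inbox /pt (negPf jk) => jn; split => //.
  by exists j => //; apply/eqP.
have g1E p : [set (latpt A k + p.1)%R] `|` ((g p : set E) `&` box n) =
    points pt (fun j => if j == k then setT else inbox j) p.
  rewrite gE; apply/seteqP; split => [_ [->|[j + <-]]|_ [j + <-]] /=.
  - by exists k; rewrite /= /pt eqxx.
  - have [->|jk] := eqVneq j k; first by rewrite /= eqxx.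
    by rewrite /= (negPf jk) => jn; exists j => //=; rewrite (negPf jk).
  - have [->|jk] := eqVneq j k; first by left; rewrite /pt eqxx.
    by rewrite /= (negPf jk) => jn; right; exists j => //=; rewrite (negPf jk).
have [mH _] := H_ham.
have Hcomp (c : E * config -> pconf) : measurable_fun setT c ->
    (forall p, lf_domain p -> finite_set (c p : set E)) ->
    measurable_fun lf_domain (fun p => H (c p)).
  move=> mc cf; apply: (measurable_comp (g := c) _ _ mH).
  - exact: measurable_finite.
  - by move=> _ [p pf <-]; exact: cf.
  - exact: measurable_funTS.
have fin p : lf_domain p -> finite_set ((g p : set E) `&` box n).
  by move=> pf; exact: Gam_locally_finite.
apply: measurable_ediff => //.
- apply: (Hcomp (fun p => [set (latpt A k + p.1)%R] `|` ((g p : set E) `&` box n))).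
    rewrite (_ : (fun p => _) = points pt (fun j => if j == k then setT else inbox j)).
      by apply: measurable_points => // j; case: ifP.
    by apply/funext => p; exact: g1E.
  by move=> p pf; rewrite finite_setU; split => //; exact: fin.
- apply: (Hcomp (fun p => (g p : set E) `&` box n)) => //.
  rewrite (_ : (fun p => _) = points pt (fun j => if j == k then set0 else inbox j)).
    by apply: measurable_points => // j; case: ifP.
  by apply/funext => p; exact: gE.
Qed.

(** The lattice boxes give an exhaustion of the configuration off [k] to which
    [energy_cvg] applies. When the [k]-th point coincides with another one, the
    two sides still agree, since both are defined from the sets of points. *)
Lemma Htilde_diff_cvg k x : A \in unitmx -> config_lf A x ->
  Htilde_diff A H [fset k]%fset x @ \oo --> site_energy k (x k, x).
Proof.
move=> A_basis xf.
have := local_energy_cvg H_ham H_hered H_case (y := (latpt A k + x k)%R)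
  (Gam_locally_finite (~` [set k]) 0%R xf) (exhausts_Gam k x A_basis).
apply: cvg_trans; apply: near_eq_cvg.
apply: filterS (Lam_eventually A k) => n kn; rewrite /Htilde_diff /Htilde.
by rewrite set_fset1 -Gam_setU1.
Qed.

Lemma Htilde_loc1 k x : A \in unitmx -> config_lf A x ->
  Htilde_loc A H [fset k]%fset x = site_energy k (x k, x).
Proof. by move=> A_basis xf; apply/cvg_lim => //; exact: Htilde_diff_cvg. Qed.

Lemma site_energy_update k y y' x : site_energy k (y, update k y' x) = site_energy k (y, x).
Proof. by rewrite /site_energy /= Gam_update. Qed.

End measurable_energy.

(** * Local finiteness of stationary perturbed lattices *)

Section counting_indices.
Context (R : realType).
Local Notation card S := (\esum_(i in S) (1 : \bar R)).

Lemma subset_esum1 (I : choiceType) (S S' : set I) : S `<=` S' -> card S <= card S'.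
Proof.
move=> SS'; apply: ereal_sup_le => _ [F [fF FS] <-]; exists F => //.
by split => //; exact: subset_trans SS'.
Qed.

Lemma esum1_finite (I : choiceType) (S : set I) : finite_set S -> card S < +oo.
Proof.
move=> fS; rewrite esum_fset// fsbig_finite//=; apply/lte_sum_pinfty => i _; exact: ltry.
Qed.

Lemma finite_esum1 (I : choiceType) (S : set I) : card S < +oo -> finite_set S.
Proof.
move=> cS; apply: contrapT => infS.
have cS_fin : card S \is a fin_num by rewrite ge0_fin_numE// esum_ge0.
pose n := (Num.truncn (fine (card S))).+1.
have [B BS nB] := infinite_set_fset n infS.
have : n%:R%:E <= card S.
  apply: (@le_trans _ _ (\sum_(i \in [set` B]) (1 : \bar R))); last first.
    by apply: ereal_sup_ubound; exists [set` B].
  rewrite fsbig_finite//= set_fsetK sumEFin lee_fin.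
  by rewrite big_const_seq count_predT iter_addr addr0 ler_nat.
rewrite -(fineK cS_fin) lee_fin leNgt; apply/negP; rewrite negbK.
exact: truncnS_gt.
Qed.

End counting_indices.

Section local_finiteness.
Context (R : realType) (d : nat) (A : 'M[R]_d) (A_basis : A \in unitmx).
Local Notation E := 'rV[R]_d.
Local Notation config := (config R d).
Variable P : probability config R.
Hypothesis P_shift : forall (j : 'rV[int]_d) (C : set config), measurable C ->
  P (shift_config j @^-1` C) = P C.

Let hits n (j : 'rV[int]_d) (a : E) : Prop := box n (latpt A j + a)%R.

(** Subtracting one such site from all the others embeds them into a box of twice
    the size. *)
Let hits_bound n (a : E) :
  \esum_(j in [set j | hits n j a]) (1 : \bar R) <=
  \esum_(j in Lam A (n + n)) (1 : \bar R).
Proof.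
have [[j0 j0a]|none] := pselect (exists j, hits n j a); last first.
  rewrite (_ : [set j | _] = set0) ?esum_set0 ?esum_ge0//.
  by apply/seteqP; split => // j ja; apply: none; exists j.
rewrite -(@esum_image _ _ _ _ (fun j => j - j0)%R (cst 1)); last first.
  by move=> i j _ _ /addIr.
apply: subset_esum1 => _ [j ja <-] i; rewrite latptB.
rewrite (_ : _ - _ = (latpt A j + a) - (latpt A j0 + a))%R; last first.
  by rewrite opprD addrACA subrr addr0.
rewrite mxE [X in (_ + X)%R]mxE natrD (le_trans (ler_normB _ _))//.
by apply: lerD; [exact: ja|exact: j0a].
Qed.

Let measurable_hits n j : measurable [set x : config | hits n j (x j)].
Proof.
have m : measurable_fun setT (fun x : config => latpt A j + x j)%R.
  by apply: measurable_rVD => //; exact: measurable_coord_config.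
by rewrite -[X in measurable X]setTI; apply: m => //; exact: measurable_box.
Qed.

(** The expected number of points in a box is finite. *)
Lemma config_lf_ae : P (~` config_lf A) = 0.
Proof.
pose c n (x : config) := \esum_(j in [set j | hits n j (x j)]) (1 : \bar R).
pose c0 n (x : config) := \esum_(j in [set j | hits n j (x 0%R)]) (1 : \bar R).
pose b n j (x : config) := (\1_[set x : config | hits n j (x j)] x)%:E : \bar R.
pose b0 n j (x : config) := (\1_[set x : config | hits n j (x 0%R)] x)%:E : \bar R.
have mhits0 n j : measurable [set x : config | hits n j (x 0%R)].
  have m : measurable_fun setT (fun x : config => latpt A j + x 0)%R.
    by apply: measurable_rVD => //; exact: measurable_coord_config.
  by rewrite -[X in measurable X]setTI; apply: m => //; exact: measurable_box.
have mb n j : measurable_fun setT (b n j).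
  by apply/measurable_EFinP/measurable_indic; exact: measurable_hits.
have mb0 n j : measurable_fun setT (b0 n j).
  by apply/measurable_EFinP; exact: measurable_indic.
have b_ge0 n j x : 0 <= b n j x by rewrite lee_fin.
have b0_ge0 n j x : 0 <= b0 n j x by rewrite lee_fin.
have cE n x : c n x = \esum_(j in setT) b n j x.
  rewrite /c esum_mkcond; apply: eq_esum => j _; rewrite /b indicE.
  by rewrite (_ : (j \in _) = (x \in [set x : config | hits n j (x j)]))//;
    case: ifP.
have c0E n x : c0 n x = \esum_(j in setT) b0 n j x.
  rewrite /c0 esum_mkcond; apply: eq_esum => j _; rewrite /b0 indicE.
  by rewrite (_ : (j \in _) = (x \in [set x : config | hits n j (x 0%R)]))//;
    case: ifP.
have mc n : measurable_fun setT (c n).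
  rewrite (_ : c n = fun x => \esum_(j in setT) b n j x); last exact/funext/cE.
  by apply: ge0_measurable_fun_esum => // j x _; rewrite lee_fin.
have intc n : \int[P]_x c n x < +oo.
  (* stationarity, term by term *)
  have -> : \int[P]_x c n x = \int[P]_x c0 n x.
    under eq_integral do rewrite cE; under [RHS]eq_integral do rewrite c0E.
    rewrite (ge0_integral_esum P setT measurableT (mb n) (fun j x _ => b_ge0 n j x)).
    rewrite (ge0_integral_esum P setT measurableT (mb0 n) (fun j x _ => b0_ge0 n j x)).
    apply: eq_esum => j _; rewrite !integral_indic//= !setIT.
    rewrite -(@P_shift j _ (mhits0 n j)).
    by congr (P _); apply/seteqP; split => x; rewrite /= /shift_config add0r.
  apply: (@le_lt_trans _ _ (\int[P]_x (cst (\esum_(j in Lam A (n + n)) 1) x))).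
    apply: ge0_le_integral => //.
    - by move=> x _; exact: esum_ge0.
    - rewrite (_ : c0 n = fun x => \esum_(j in setT) b0 n j x); last exact/funext/c0E.
      by apply: ge0_measurable_fun_esum => // j x _; rewrite lee_fin.
    - by move=> x _; exact: hits_bound.
  rewrite integral_cst// [X in _ * X](_ : _ = 1) ?mule1; last exact: probability_setT.
  exact/esum1_finite/finite_Lam.
have c_ae n : {ae P, forall x, setT x -> c n x \is a fin_num}.
  apply: integrable_ae => //; apply/integrableP; split => //.
  by under eq_integral do rewrite gee0_abs ?esum_ge0//.
apply: measure_negligible; first by apply: measurableC; exact: measurable_config_lf.
have : {ae P, forall x, forall n, setT x -> c n x \is a fin_num} by apply/ae_foralln.
apply: negligibleS => x /= xf; apply: contra_not xf => cx n.
have cfin : finite_set [set j | hits n j (x j)].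
  by apply: finite_esum1; rewrite -ge0_fin_numE ?esum_ge0//; exact: cx.
apply: (sub_finite_set _ (finite_image (fun j => latpt A j + x j + 0)%R cfin)).
by move=> _ [[j _ <-] jn]; exists j => //; move: jn; rewrite addr0.
Qed.

End local_finiteness.

(** * Integrals against the move distribution *)

Section tuple_measure1.
Context dd (T : measurableType dd) (R : realType).
Variable m : {sigma_finite_measure set T -> \bar R}.

Lemma ge0_integral_tuple_measure1 (B : set T) (F : T -> \bar R) :
  measurable B -> measurable_fun setT F -> (forall y, 0 <= F y) ->
  \int[tuple_measure m 1]_(t in [set t | B (tnth t ord0)]) F (tnth t ord0) =
  \int[m]_(y in B) F y.
Proof.
move=> mB mF F0.
have mF' : measurable_fun setT (F \_ B).
  by apply/(measurable_restrictT _ _).1 => //; exact: measurable_funTS.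
have F'0 y : 0 <= (F \_ B) y by rewrite erestrict_ge0.
have mt : measurable_fun setT (fun t : 1.-tuple T => tnth t ord0).
  exact: measurable_tnth.
rewrite integral_mkcond [RHS]integral_mkcond.
transitivity (\int[tuple_measure m 1]_t (F \_ B) (tnth t ord0)).
  by apply: eq_integral => t _; rewrite !patchE.
rewrite /= /tuple_step ge0_integral_pushforward//=; last first.
  exact: measurableT_comp mF' mt.
rewrite preimage_setT.
transitivity (\int[m \x \d_([tuple] : 0.-tuple T)]_p (F \_ B) p.1).
  by apply: eq_integral => p _; rewrite (tnth_nth p.1).
rewrite (fubini_tonelli1 (fun p => (F \_ B) p.1))//; last first.
  exact: measurableT_comp mF' measurable_fst.
apply: eq_integral => y _.
by rewrite /fubini_F/= integral_dirac//= diracE mem_set// mul1e.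
Qed.

End tuple_measure1.

Section density_wrt_Q.
Context (R : realType) (d : nat).
Local Notation E := 'rV[R]_d.
Variable Q : probability E R.

Lemma measurable_enorm_ball (x : E) r : measurable [set y | (enorm (y - x) < r)%R].
Proof.
have m : measurable_fun [set: E] (fun y : E => enorm (y - x)).
  apply: measurableT_comp; first exact: measurable_enorm.
  exact: measurable_rVD.
rewrite (_ : [set y | _] = (fun y : E => enorm (y - x)) @^-1` [set` `]-oo, r[]).
  by rewrite -[X in measurable X]setTI; apply: m => //; exact: measurable_itv.
by apply/seteqP; split => y /=; rewrite in_itv.
Qed.

Let cube (c : 'rV[rat]_d) (s : rat) : set E :=
  [set y | forall i, (`|y ord0 i - ratr (c ord0 i)| < ratr s)%R].

Let measurable_cube c s : measurable (cube c s).
Proof.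
rewrite (_ : cube c s = \bigcap_(i in [set: 'I_d])
   ((fun x : E => `|x ord0 i - ratr (c ord0 i)|%R) @^-1` [set` `]-oo, (ratr s : R)[])); last first.
  by apply/seteqP; split => [x xn i _|x xn i]; have := xn i; rewrite /= in_itv //= ; apply.
apply: countable_bigcap_measurable => i _.
have mf : measurable_fun [set: E] (fun x : E => `|x ord0 i - ratr (c ord0 i)|%R).
  apply: measurableT_comp => //; apply: measurable_funB => //.
  exact: measurable_coord.
by rewrite -[X in measurable X]setTI; apply: mf => //; exact: measurable_itv.
Qed.

Let enorm_le_sum (x : E) : (enorm x <= \sum_i `|x ord0 i|)%R.
Proof.
have S0 : (0 <= \sum_i `|x ord0 i|)%R by apply: sumr_ge0.
rewrite -[leRHS]ger0_norm// -sqrtr_sqr ler_wsqrtr// expr2 mulr_suml.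
apply: ler_sum => i _; rewrite -real_normK ?num_real// expr2 ler_wpM2l//.
by rewrite (bigD1 i)//= lerDl sumr_ge0.
Qed.

(** The rational cubes form a countable basis of the topology, so that the
    complement of the support is a countable union of null sets. *)
Let support_compl : ~` msupport Q = \bigcup_(cs in [set cs : 'rV[rat]_d * rat |
  Q (cube cs.1 cs.2) = 0]) cube cs.1 cs.2.
Proof.
apply/seteqP; split => [x /= /existsNP[r /not_implyP[r0 /negP]]|x [[c s] /= Q0 xcs]].
  rewrite -leNgt => Qr.
  (* a cube of half side s has all its points within 2 d s of x *)
  have [s] := rat_in_itvoo (divr_gt0 r0 (ltr0n _ (d + d).+1)).
  rewrite in_itv/= => /andP[s0 sr].
  have near_x i : exists c : rat, (`|x ord0 i - ratr c| < ratr s)%R.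
    have [c] := @rat_in_itvoo R (x ord0 i - ratr s)%R (x ord0 i + ratr s)%R ltac:(lra).
    by rewrite in_itv/= => cx; exists c; rewrite ltr_norml; lra.
  have [c cx] := choice near_x.
  exists (\row_i c i, s) => /=; last by move=> i; rewrite mxE; exact: cx.
  apply/eqP; rewrite eq_le measure_ge0 andbT (le_trans _ Qr)//.
  apply: le_measure; rewrite ?inE; [exact: measurable_cube|exact: measurable_enorm_ball|].
  move=> y yc /=; apply: le_lt_trans (enorm_le_sum _) _.
  apply: (@le_lt_trans _ _ (\sum_(i < d) (ratr s + ratr s))%R).
    apply: ler_sum => i _; rewrite !mxE.
    have := yc i; have := cx i; rewrite mxE !ltr_norml => h1 h2.
    by rewrite ler_norml; lra.
  rewrite sumr_const card_ord mulrnDl -mulrnDr.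
  by move: sr; rewrite ltr_pdivlMr// mulr_natr; apply: le_lt_trans; rewrite ler_wpMn2l// ltW.
pose r := \big[Num.min/1%R]_(i < d) (ratr s - `|x ord0 i - ratr (c ord0 i)|)%R.
have r0 : (0 < r)%R by apply: lt_bigmin => // i _; rewrite subr_gt0; exact: xcs.
move=> /(_ r r0); apply/negP; rewrite -leNgt -Q0.
apply: le_measure; rewrite ?inE; [exact: measurable_enorm_ball|exact: measurable_cube|].
move=> y /= yr i; have := le_lt_trans (le_coord_enorm (y - x) i) yr.
move=> /lt_le_trans/(_ (bigmin_le_cond _ _ (isT : xpredT i))).
rewrite !mxE => h; rewrite -(subrK (x ord0 i) (y ord0 i)) -addrA.
by rewrite (le_lt_trans (ler_normD _ _))//; lra.
Qed.

Lemma measurable_msupport : measurable (msupport Q).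
Proof.
rewrite -(setCK (msupport Q)); apply: measurableC; rewrite support_compl.
by apply: countable_bigcup_measurable => cs _.
Qed.

Lemma msupportC0 : Q (~` msupport Q) = 0.
Proof.
apply: measure_negligible; first by apply: measurableC; exact: measurable_msupport.
rewrite support_compl; apply: countable_bigcup_negligible => cs Q0.
by exists (cube cs.1 cs.2); split.
Qed.

Variable q : E -> \bar R.
Hypotheses (q_meas : measurable_fun setT q)
  (Q_density : forall C, measurable C -> Q C = \int[leb]_(x in C) lambda1 q x).

Lemma measurable_lambda1 : measurable_fun setT (lambda1 q).
Proof.
apply: measurableT_comp; first exact: measurable_expeR.
exact: measurableT_comp.
Qed.

Lemma ge0_integral_lambda1 (g : E -> \bar R) : measurable_fun setT g ->
  (forall y, 0 <= g y) ->
  \int[leb]_(y in msupport Q) (g y * lambda1 q y) = \int[Q]_y g y.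
Proof.
move=> mg g0; have mS := measurable_msupport.
rewrite (@ge0_negligible_integral _ _ _ Q setT (~` msupport Q))//; last 2 first.
- exact: measurableC.
- exact: msupportC0.
rewrite setTD setCK [RHS]integral_mkcond (ge0_integral_density measurable_lambda1 _ Q_density)//.
- rewrite [LHS]integral_mkcond; apply: (@eq_integral _ _ R leb) => y _; rewrite !patchE.
  by case: ifP; rewrite ?mul0e.
- by move=> y; exact: expeR_ge0.
- exact/(measurable_restrictT _ _).1/measurable_funTS.
- by move=> y; rewrite erestrict_ge0.
Qed.

End density_wrt_Q.

(** * The conditional law of a single perturbation *)

Section single_site.
Context (R : realType) (d : nat).
Local Notation E := 'rV[R]_d.
Local Notation config := (config R d).
Variable Q : probability E R.

Lemma measurable_nth0 (s : seq 'rV[int]_d) k (B : set E) : s = [:: k] ->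
  measurable B -> measurable [set t : (size s).-tuple E | B (nth 0%R t 0)].
Proof.
move=> -> mB; rewrite (_ : [set t | _] = (fun t : 1.-tuple E => tnth t ord0) @^-1` B).
  by rewrite -[X in measurable X]setTI; exact: measurable_tnth.
by apply/seteqP; split => t /=; rewrite (tnth_nth 0%R).
Qed.

(** The enumeration of the singleton set is [:: k] only up to a propositional
    equality, on which the types of the tuples depend; hence the list [s]. *)
Lemma integral_override1 (s : seq 'rV[int]_d) k (B : set E) (F : config -> \bar R)
    (x : config) : s = [:: k] -> measurable B ->
  measurable_fun setT (fun y => F (update k y x)) ->
  (forall y, 0 <= F (update k y x)) ->
  \int[tuple_measure Q (size s)]_(t in [set t | B (nth 0%R t 0)])
    F (fun j => nth (x j) t (index j s)) =
  \int[Q]_(y in B) F (update k y x).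
Proof.
move=> -> mB mF F0; rewrite -(ge0_integral_tuple_measure1 Q mB mF F0).
rewrite integral_mkcond [RHS]integral_mkcond; apply: eq_integral => t _.
rewrite !patchE; congr (if _ then F _ else _).
  by apply/idP/idP => /[!inE] /=; rewrite (tnth_nth 0%R).
apply/funext => j; rewrite /update /= eq_sym.
case: eqVneq => jk; first by rewrite (tnth_nth (x j)).
by rewrite nth_default// size_tuple.
Qed.

End single_site.

Section single_site_gibbs.
Context (R : realType) (d : nat) (A : 'M[R]_d) (A_basis : A \in unitmx).
Local Notation E := 'rV[R]_d.
Local Notation config := (config R d).
Variables (Q : probability E R) (H : pconf R d -> \bar R).
Hypotheses (H_ham : is_hamiltonian H) (H_hered : hereditary_hamiltonian H).
Hypothesis H_case : finite_range H \/ summable_pairwise H.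
Variable k : 'rV[int]_d.

Definition site_weight (p : E * config) : \bar R := expeR (- site_energy A H k p).

Definition site_partition (x : config) : \bar R := \int[Q]_y site_weight (y, x).

(** The density of the conditional law of [X_k] with respect to [Q], set to zero off
    the locally finite configurations to make it measurable everywhere. *)
Definition site_density : E * config -> \bar R :=
  (fun p => site_weight p * (site_partition p.2)^-1) \_ (lf_domain A).

Lemma site_weight_ge0 p : 0 <= site_weight p.
Proof. exact: expeR_ge0. Qed.

Lemma measurable_site_weight : measurable_fun (lf_domain A) site_weight.
Proof.
apply: (measurableT_comp (@measurable_expeR R)).
by apply: measurableT_comp => //; exact: measurable_site_energy.
Qed.

Lemma measurable_site_weight1 x : config_lf A x ->
  measurable_fun setT (fun y => site_weight (y, x)).
Proof.
move=> xf.
have m : measurable_fun setT (site_weight \_ (lf_domain A)).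
  by apply/(measurable_restrictT _ _).1; [exact: measurable_lf_domain|exact: measurable_site_weight].
rewrite (_ : (fun y => _) = (fun y => (site_weight \_ (lf_domain A)) (y, x))).
  exact: measurableT_comp m (pair2_measurable x).
by apply/funext => y; rewrite patchE mem_set.
Qed.

Lemma measurable_site_partition : measurable_fun (config_lf A) site_partition.
Proof.
pose w := site_weight \_ (lf_domain A).
have mw : measurable_fun setT w.
  by apply/(measurable_restrictT _ _).1; [exact: measurable_lf_domain|exact: measurable_site_weight].
have w0 p : 0 <= w p by rewrite erestrict_ge0// => ? _; exact: site_weight_ge0.
have := measurable_fun_fubini_tonelli_G (m1 := Q) w mw w0.
move=> /(measurable_funTS (D := config_lf A)); apply: eq_measurable_fun => x /[!inE] xf.
by apply: eq_integral => y _; rewrite /w patchE mem_set.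
Qed.

Lemma measurable_site_density : measurable_fun setT site_density.
Proof.
apply/(measurable_restrictT _ _).1; first exact: measurable_lf_domain.
apply: emeasurable_funM; first exact: measurable_site_weight.
apply: (measurableT_comp (@measurable_inve R)).
apply: (measurable_comp (measurable_config_lf A) _ measurable_site_partition).
  by move=> _ [p pf <-].
by apply: measurable_funTS; exact: measurable_snd.
Qed.

Lemma site_density_ge0 p : 0 <= site_density p.
Proof.
rewrite erestrict_ge0// => {}p _; rewrite mule_ge0 ?site_weight_ge0//.
by rewrite inve_ge0 integral_ge0// => y _; exact: site_weight_ge0.
Qed.

Let Htilde_loc_update x y : config_lf A x ->
  Htilde_loc A H [fset k]%fset (update k y x) = site_energy A H k (y, x).
Proof.
move=> xf; rewrite Htilde_loc1//; last exact: config_lf_update.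
by rewrite /update eqxx -/(update k y x) site_energy_update.
Qed.

Let measurable_weight_update x : config_lf A x -> measurable_fun setT
  (fun y => expeR (- Htilde_loc A H [fset k]%fset (update k y x))).
Proof.
move=> xf; rewrite (_ : (fun y => _) = (fun y => site_weight (y, x))).
  exact: measurable_site_weight1.
by apply/funext => y; rewrite Htilde_loc_update.
Qed.

Lemma partition_function1 x : config_lf A x ->
  partition_function A H Q [fset k]%fset x = site_partition x.
Proof.
move=> xf; have := integral_override1 Q (x := x)
  (F := fun c => expeR (- Htilde_loc A H [fset k]%fset c)) (esym (fset_seq1 k))
  measurableT (measurable_weight_update xf) (fun y => expeR_ge0 _).
rewrite /partition_function /Qprod /override => ->; apply: eq_integral => y _.
by rewrite Htilde_loc_update.
Qed.

Lemma gibbs_kernel1 (B : set E) (x : config) : measurable B -> config_lf A x ->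
  gibbs_kernel A H Q x ([set t | B (nth 0%R t 0)] : set ((size [fset k]%fset).-tuple E)) =
  \int[Q]_(y in B) site_density (y, x).
Proof.
move=> mB xf; have := integral_override1 Q (x := x)
  (F := fun c => expeR (- Htilde_loc A H [fset k]%fset c)) (esym (fset_seq1 k))
  mB (measurable_weight_update xf) (fun y => expeR_ge0 _).
rewrite /gibbs_kernel partition_function1// /Qprod /override => ->.
rewrite muleC -ge0_integralZr//; last 3 first.
- by apply: measurable_funTS; exact: measurable_weight_update.
- by move=> y _; exact: expeR_ge0.
- by rewrite inve_ge0 integral_ge0// => y _; exact: site_weight_ge0.
apply: eq_integral => y _; rewrite /site_density patchE mem_set//=.
by rewrite Htilde_loc_update.
Qed.

Variable P : probability config R.
Hypothesis P_gibbs : gibbs_measure A H Q P.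

Let P_shift : forall (j : 'rV[int]_d) (C : set config), measurable C ->
  P (shift_config j @^-1` C) = P C.
Proof. by case: P_gibbs. Qed.

(** Let [z] erase the value of a configuration at [k]. An event on [z x] depends only
    on the coordinates off [k], so that the DLR equation gives the law of the pair
    ([x k], [z x]) on rectangles, which determine it. *)
Lemma gibbs_disintegration (g : E * config -> \bar R) :
  measurable_fun setT g -> (forall p, 0 <= g p) ->
  (forall y y' x, g (y, update k y' x) = g (y, x)) ->
  \int[P]_x g (x k, x) = \int[P]_x \int[Q]_y (g (y, x) * site_density (y, x)).
Proof.
move=> mg g0 g_update.
have [nu2 nu2E] := density_measure (Q \x P) measurable_site_density site_density_ge0.
pose z : config -> config := fun x => update k 0%R x.
have z_off C : measurable C -> <<s coord_events (~` [set` [fset k]%fset]) >> (z @^-1` C).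
  move=> mC; pose S := coord_events (R := R) (~` [set` [fset k]%fset]).
  have mz' : measurable_fun [set: g_sigma_algebraType S] (z : g_sigma_algebraType S -> config).
    apply: measurable_fun_config => j; rewrite /z /update.
    case: eqVneq => [_|jk]; first exact: measurable_cst.
    move=> _ B mB; rewrite setTI; apply: sub_sigma_algebra; exists j, B; split => //=.
    by rewrite inE; apply/negP.
  by have := mz' measurableT C mC; rewrite setTI.
have mz : measurable_fun setT z.
  apply: measurable_fun_config => j; rewrite /z /update.
  case: eqVneq => [_|_]; first exact: measurable_cst.
  exact: measurable_coord_config.
pose phi (x : config) : E * config := (x k, z x).
pose psi (p : E * config) : E * config := (p.1, z p.2).
have mphi : measurable_fun setT phi.
  by apply: measurable_fun_pair => //; exact: measurable_coord_config.
have mpsi : measurable_fun setT psi.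
  by apply: measurable_fun_pair; [exact: measurable_fst|exact: measurableT_comp mz measurable_snd].
pose G : set (set (E * config)) := [set B `*` C | B in measurable & C in measurable].
transitivity (\int[nu2]_p g p); last first.
  rewrite (ge0_integral_density measurable_site_density site_density_ge0 nu2E)//.
  rewrite (fubini_tonelli2 (fun p => g p * site_density p))//.
    by apply: emeasurable_funM => //; exact: measurable_site_density.
  by move=> p; rewrite mule_ge0// site_density_ge0.
transitivity (\int[P]_x g (phi x)).
  by apply: eq_integral => x _; rewrite /phi /z g_update.
transitivity (\int[nu2]_p g (psi p)); last first.
  by apply: eq_integral => -[y x] _; rewrite /psi /z /= g_update.
apply: (@eq_integral_generator _ _ _ _ _ _ _ _ _ _ _ G) => //.
- exact: measurable_prod_measurableType.
- move=> _ _ [B1 mB1 [C1 mC1 <-]] [B2 mB2 [C2 mC2 <-]].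
  exists (B1 `&` B2); first exact: measurableI.
  by exists (C1 `&` C2); [exact: measurableI|rewrite setXI].
- by exists setT => //; exists setT => //; rewrite setXTT.
- move=> _ [B mB [C mC <-]].
  have mzC : measurable (z @^-1` C) by rewrite -[X in measurable X]setTI; exact: mz.
  rewrite (_ : psi @^-1` _ = B `*` (z @^-1` C)); last by [].
  rewrite nu2E; last exact: measurableX.
  have [_ /(_ [fset k]%fset)[_ /(_ [set t | B (nth 0%R t 0)] (z @^-1` C))]] := P_gibbs.
  rewrite (_ : _ `&` _ = phi @^-1` (B `*` C)); last first.
    apply/seteqP; split => x /=; rewrite /restr_config /= -fset_seq1 /=.
      by case.
    by case.
  move=> /(_ (measurable_nth0 (esym (fset_seq1 k)) mB) (z_off _ mC)) E.
  apply: (etrans E); rewrite [LHS]integral_mkcond [RHS]integral_mkcond.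
  rewrite fubini_tonelli2/=; last 2 first.
  - apply/(measurable_restrictT _ _).1; first exact: measurableX.
    by apply: measurable_funTS; exact: measurable_site_density.
  - by move=> p; rewrite erestrict_ge0// => ? _; exact: site_density_ge0.
  apply: (@eq_integral_null_set _ _ _ P (~` config_lf A)).
  - by apply: measurableC; exact: measurable_config_lf.
  - exact: config_lf_ae.
  move=> x /contrapT xf; rewrite patchE gibbs_kernel1// /fubini_G.
  case: ifPn => xC; last first.
    rewrite integral0_eq// => y _; rewrite patchE ifF//.
    by apply/negbTE; apply: contra xC => /[!inE] -[].
  rewrite [LHS]integral_mkcond; apply: eq_integral => y _; rewrite !patchE.
  congr (if _ then _ else _); apply/idP/idP => /[!inE]; last by case.
  by move=> yB; split => //; exact: set_mem.
- by rewrite [X in X < _](_ : _ = 1) ?ltry//; exact: probability_setT.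
Qed.

End single_site_gibbs.

(** * Reduction of the kernel Lambda to the conditional law *)

Lemma Lambda_ge0 (R : realType) (d : nat) (Q : probability 'rV[R]_d R)
    (H : pconf R d -> \bar R) (q : 'rV[R]_d -> \bar R) (i y : 'rV[R]_d) (g : pconf R d) :
  0 <= Lambda H Q q i y g.
Proof.
have lambda_ge0 z : 0 <= lambda H q i z g by rewrite mule_ge0// expeR_ge0.
by rewrite /Lambda mule_ge0// inve_ge0 integral_ge0.
Qed.

Section reduction_to_Q.
Context (R : realType) (d : nat) (A : 'M[R]_d).
Local Notation E := 'rV[R]_d.
Local Notation config := (config R d).
Variables (Q : probability E R) (H : pconf R d -> \bar R).
Hypotheses (H_ham : is_hamiltonian H) (H_hered : hereditary_hamiltonian H).
Hypothesis H_transl : translation_invariant H.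
Hypothesis H_case : finite_range H \/ summable_pairwise H.
Variable q : E -> \bar R.
Hypotheses (q_meas : measurable_fun setT q)
  (Q_density : forall C, measurable C -> Q C = \int[leb]_(x in C) lambda1 q x).
Variable u : E.
Implicit Types (k : 'rV[int]_d) (x : config) (y : E).

Lemma lambda2_site_weight k x y : config_lf A x ->
  lambda2 H (latpt A k + u + y)%R (Gam A (~` [set k]) x u) = site_weight A H k (y, x).
Proof.
move=> xf; rewrite /lambda2 /site_weight /site_energy/= Gam_translate addrAC.
by rewrite local_energy_translate//; exact: Gam_locally_finite.
Qed.

(** The normalization of [Lambda] is the partition function of the site, because
    [lambda_1] is the density of [Q]. *)
Lemma ge0_integral_Lambda k x (h : E -> \bar R) : config_lf A x ->
  measurable_fun setT h -> (forall y, 0 <= h y) ->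
  \int[leb]_(y in msupport Q)
    (h y * Lambda H Q q (latpt A k + u)%R y (Gam A (~` [set k]) x u)) =
  \int[Q]_y (h y * site_density A Q H k (y, x)).
Proof.
move=> xf mh h0.
have lambdaE y : lambda H q (latpt A k + u)%R y (Gam A (~` [set k]) x u) =
    site_weight A H k (y, x) * lambda1 q y.
  by rewrite /lambda lambda2_site_weight// muleC.
have densityE y : site_density A Q H k (y, x) =
    site_weight A H k (y, x) * (site_partition A Q H k x)^-1.
  by rewrite /site_density patchE mem_set.
have mw := measurable_site_weight1 H_ham H_hered H_case k xf.
have ZE : \int[leb]_(z in msupport Q)
    lambda H q (latpt A k + u)%R z (Gam A (~` [set k]) x u) = site_partition A Q H k x.
  under eq_integral do rewrite lambdaE.
  by apply: ge0_integral_lambda1 => // z; exact: site_weight_ge0.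
rewrite -(ge0_integral_lambda1 q_meas Q_density (g := fun y => h y * site_density A Q H k (y, x))).
- apply: eq_integral => y _; rewrite /Lambda ZE lambdaE densityE.
  by rewrite -!muleA; congr (_ * (_ * _)); rewrite muleC.
- apply: emeasurable_funM => //.
  exact: measurableT_comp (measurable_site_density A Q H_ham H_hered H_case k) (pair2_measurable x).
- by move=> y; rewrite mule_ge0// site_density_ge0.
Qed.

End reduction_to_Q.

(** * The formula for non-negative functions *)

Section random_configuration.
Context (R : realType) (d : nat) (A : 'M[R]_d) (A_basis : A \in unitmx).
Local Notation E := 'rV[R]_d.
Local Notation config := (config R d).
Context (d0 : measure_display) (Omega : measurableType d0) (Pr : probability Omega R).
Variable X : {RV Pr >-> config}.
Local Notation P := (distribution Pr X).
Hypothesis P_shift : forall (j : 'rV[int]_d) (C : set config), measurable C ->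
  P (shift_config j @^-1` C) = P C.

Let lf_ae : P (~` config_lf A) = 0.
Proof. exact: config_lf_ae. Qed.

Lemma ge0_integral_RV (F : config -> \bar R) : measurable_fun (config_lf A) F ->
  (forall x, config_lf A x -> 0 <= F x) ->
  \int[Pr]_w F (X w) = \int[P]_(x in config_lf A) F x.
Proof.
move=> mF F0; have mlf := measurable_config_lf A.
rewrite (integral_null_set (N := X @^-1` (~` config_lf A)))//; last first.
  by rewrite -[X in measurable X]setTI; apply: measurable_funP => //; exact: measurableC.
rewrite preimage_setC setCK ge0_integral_pushforward//.
by move=> x /[!inE]; exact: F0.
Qed.

(** Positive and negative parts are integrated separately; the decomposition of [F]
    is needed only where both are finite, that is almost everywhere. *)
Lemma integral_RV_diff (F Fp Fm : config -> \bar R) :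
  measurable_fun (config_lf A) Fp -> measurable_fun (config_lf A) Fm ->
  (forall x, config_lf A x -> 0 <= Fp x) -> (forall x, config_lf A x -> 0 <= Fm x) ->
  \int[P]_(x in config_lf A) Fp x < +oo -> \int[P]_(x in config_lf A) Fm x < +oo ->
  (forall x, config_lf A x -> Fp x < +oo -> Fm x < +oo -> F x = Fp x - Fm x) ->
  \int[Pr]_w F (X w) =
  \int[P]_(x in config_lf A) Fp x - \int[P]_(x in config_lf A) Fm x.
Proof.
move=> mFp mFm Fp0 Fm0 Fp_fin Fm_fin FE; have mlf := measurable_config_lf A.
pose lfX := X @^-1` config_lf A.
have mlfX : measurable lfX.
  by rewrite -[X in measurable X]setTI; exact: measurable_funP.
have mX : measurable_fun setT X by exact: measurable_funP.
have mcomp (G : config -> \bar R) : measurable_fun (config_lf A) G ->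
    measurable_fun lfX (G \o X).
  move=> mG; apply: (measurable_comp mlf) => //; first by move=> _ [w Xw <-].
  exact: measurable_funTS.
have pushE (G : config -> \bar R) : measurable_fun (config_lf A) G ->
    (forall x, config_lf A x -> 0 <= G x) ->
    \int[P]_(x in config_lf A) G x = \int[Pr]_(w in lfX) (G \o X) w.
  move=> mG G0; rewrite ge0_integral_pushforward// => x /[!inE]; exact: G0.
have intX (G : config -> \bar R) : measurable_fun (config_lf A) G ->
    (forall x, config_lf A x -> 0 <= G x) ->
    \int[P]_(x in config_lf A) G x < +oo -> Pr.-integrable lfX (G \o X).
  move=> mG G0 Gfin; apply/integrableP; split; first exact: mcomp.
  rewrite (eq_integral (G \o X)) -?pushE// => w /[!inE] Xw.
  by rewrite gee0_abs//; exact: G0.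
have iFp := intX _ mFp Fp0 Fp_fin; have iFm := intX _ mFm Fm0 Fm_fin.
rewrite !pushE// -integralB//.
have [N [mN N0 NF]] : {ae Pr, forall w, lfX w ->
    ((Fp \o X) w \is a fin_num) /\ ((Fm \o X) w \is a fin_num)}.
  have := integrable_ae mlfX iFp; have := integrable_ae mlfX iFm.
  by apply: filterS2 => w hm hp Xw; split; [exact: hp|exact: hm].
have mlfXC : measurable (~` lfX) by exact: measurableC.
have lfX0 : Pr (~` lfX) = 0 by exact: lf_ae.
rewrite [RHS]integral_mkcond; apply: (eq_integral_null_set (N := N `|` ~` lfX)).
- exact: measurableU.
- exact: null_set_setU.
move=> w /not_orP[wN /contrapT Xw]; rewrite patchE mem_set//.
have [hp hm] : (Fp \o X) w \is a fin_num /\ (Fm \o X) w \is a fin_num.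
  by apply: contrapT => h; apply: wN; apply: NF => /= /(_ Xw).
by apply: FE => //; rewrite -ge0_fin_numE//; [exact: Fp0|exact: Fm0].
Qed.

End random_configuration.

Section georgii_nguyen_zessin.
Context (R : realType) (d : nat) (A : 'M[R]_d) (A_basis : A \in unitmx).
Local Notation E := 'rV[R]_d.
Local Notation config := (config R d).
Variables (Q : probability E R) (H : pconf R d -> \bar R).
Hypotheses (H_ham : is_hamiltonian H) (H_hered : hereditary_hamiltonian H).
Hypothesis H_transl : translation_invariant H.
Hypothesis H_case : finite_range H \/ summable_pairwise H.
Variable q : E -> \bar R.
Hypotheses (q_meas : measurable_fun setT q)
  (Q_density : forall C, measurable C -> Q C = \int[leb]_(x in C) lambda1 q x).
Variable u : E.
Variable P : probability config R.
Hypothesis P_gibbs : gibbs_measure A H Q P.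
Implicit Types (k : 'rV[int]_d) (x : config) (y : E).

Local Notation Lambda_at k x y :=
  (Lambda H Q q (latpt A k + u)%R y (Gam A (~` [set k]) x u)).

Section one_site.
Variables (k : 'rV[int]_d) (g : E * config -> \bar R).
Hypotheses (mg : measurable_fun (lf_domain A) g) (g_ge0 : forall p, 0 <= g p).
Hypothesis g_update : forall y y' x, g (y, update k y' x) = g (y, x).

Let gT := g \_ (lf_domain A).

Let measurable_gT : measurable_fun setT gT.
Proof. by apply/(measurable_restrictT _ _).1 => //; exact: measurable_lf_domain. Qed.

Let gT_ge0 p : 0 <= gT p.
Proof. by rewrite erestrict_ge0. Qed.

Let gTE x y : config_lf A x -> gT (y, x) = g (y, x).
Proof. by move=> xf; rewrite /gT patchE mem_set. Qed.

Let gT_update y y' x : gT (y, update k y' x) = gT (y, x).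
Proof.
rewrite /gT !patchE g_update; congr (if _ then _ else _).
by apply/idP/idP => /[!inE]; rewrite /lf_domain /= config_lf_updateE.
Qed.

Lemma integral_LambdaE x : config_lf A x ->
  \int[leb]_(y in msupport Q) (g (y, x) * Lambda_at k x y) =
  \int[Q]_y (gT (y, x) * site_density A Q H k (y, x)).
Proof.
move=> xf; rewrite -(ge0_integral_Lambda H_ham H_hered H_transl H_case q_meas Q_density u
    k xf (h := fun y => gT (y, x)))//.
  by apply: eq_integral => y _; rewrite gTE.
exact: measurableT_comp measurable_gT (pair2_measurable x).
Qed.

Lemma measurable_integral_Lambda : measurable_fun (config_lf A)
  (fun x => \int[leb]_(y in msupport Q) (g (y, x) * Lambda_at k x y)).
Proof.
pose F p := gT p * site_density A Q H k p.
have mF : measurable_fun setT F.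
  apply: emeasurable_funM => //.
  exact: (measurable_site_density A Q H_ham H_hered H_case k).
have F0 p : 0 <= F p by rewrite mule_ge0// site_density_ge0.
have := measurable_fun_fubini_tonelli_G (m1 := Q) F mF F0.
move=> /(measurable_funTS (D := config_lf A)); apply: eq_measurable_fun => x /[!inE] xf.
by rewrite integral_LambdaE.
Qed.

Lemma measurable_own_site : measurable_fun (config_lf A) (fun x => g (x k, x)).
Proof.
have m : measurable_fun setT (fun x : config => gT (x k, x)).
  apply: (measurableT_comp measurable_gT).
  by apply: measurable_fun_pair => //; exact: measurable_coord_config.
have := measurable_funTS (D := config_lf A) m.
by apply: eq_measurable_fun => x /[!inE] xf; rewrite gTE.
Qed.

Lemma ge0_georgii1 :
  \int[P]_(x in config_lf A) g (x k, x) =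
  \int[P]_(x in config_lf A)
    \int[leb]_(y in msupport Q) (g (y, x) * Lambda_at k x y).
Proof.
have lfC : P (~` config_lf A) = 0 by apply: config_lf_ae => //; case: P_gibbs.
have mlfC : measurable (~` config_lf A).
  by apply: measurableC; exact: measurable_config_lf.
transitivity (\int[P]_x gT (x k, x)).
  rewrite [RHS](integral_null_set _ mlfC lfC) setCK.
  by apply: eq_integral => x /[!inE] xf; rewrite gTE.
rewrite (gibbs_disintegration A_basis H_ham H_hered H_case P_gibbs measurable_gT gT_ge0 gT_update).
rewrite (integral_null_set _ mlfC lfC) setCK.
by apply: eq_integral => x /[!inE] xf; rewrite integral_LambdaE.
Qed.

End one_site.

Section all_sites.
Variable g : 'rV[int]_d -> E * config -> \bar R.
Hypotheses (mg : forall k, measurable_fun (lf_domain A) (g k))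
  (g_ge0 : forall k p, 0 <= g k p)
  (g_update : forall k y y' x, g k (y, update k y' x) = g k (y, x)).

Lemma integral_Lambda_ge0 k x :
  0 <= \int[leb]_(y in msupport Q) (g k (y, x) * Lambda_at k x y).
Proof. by apply: integral_ge0 => y _; rewrite mule_ge0// Lambda_ge0. Qed.

Lemma ge0_georgii (S : set 'rV[int]_d) :
  \int[P]_(x in config_lf A) (\esum_(k in S) g k (x k, x)) =
  \int[P]_(x in config_lf A) (\esum_(k in S)
    \int[leb]_(y in msupport Q) (g k (y, x) * Lambda_at k x y)).
Proof.
have mlf := measurable_config_lf A.
rewrite !ge0_integral_esum//.
- by apply: eq_esum => k _; exact: ge0_georgii1.
- by move=> k; apply: measurable_integral_Lambda.
- by move=> k x _; exact: integral_Lambda_ge0.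
- by move=> k; apply: measurable_own_site.
Qed.

Lemma measurable_esum_own_site (S : set 'rV[int]_d) :
  measurable_fun (config_lf A) (fun x => \esum_(k in S) g k (x k, x)).
Proof.
by apply: ge0_measurable_fun_esum => // k; exact: measurable_own_site.
Qed.

Lemma measurable_esum_Lambda (S : set 'rV[int]_d) :
  measurable_fun (config_lf A) (fun x => \esum_(k in S)
    \int[leb]_(y in msupport Q) (g k (y, x) * Lambda_at k x y)).
Proof.
apply: ge0_measurable_fun_esum => [k|k x _]; first exact: measurable_integral_Lambda.
exact: integral_Lambda_ge0.
Qed.

End all_sites.

End georgii_nguyen_zessin.

(** * The formula for signed functions *)

Section signed.
Context (R : realType) (d : nat) (A : 'M[R]_d) (A_basis : A \in unitmx).
Local Notation E := 'rV[R]_d.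
Local Notation config := (config R d).
Variables (Q : probability E R) (H : pconf R d -> \bar R).
Hypotheses (H_ham : is_hamiltonian H) (H_hered : hereditary_hamiltonian H).
Hypothesis H_transl : translation_invariant H.
Hypothesis H_case : finite_range H \/ summable_pairwise H.
Variable q : E -> \bar R.
Hypotheses (q_meas : measurable_fun setT q)
  (Q_density : forall C, measurable C -> Q C = \int[leb]_(x in C) lambda1 q x).
Variable u : E.
Context (d0 : measure_display) (Omega : measurableType d0) (Pr : probability Omega R).
Variable X : {RV Pr >-> config}.
Local Notation P := (distribution Pr X).
Hypothesis P_gibbs : gibbs_measure A H Q P.
Variable f : E -> E -> pconf R d -> R.
Hypothesis f_meas : measurable_fun
  [set p : E * E * pconf R d | lattice_shift A u p.1.1 /\ locally_finite p.2]
  (fun p => f p.1.1 p.1.2 p.2).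
Implicit Types (k : 'rV[int]_d) (x : config) (y : E).

Local Notation Lambda_at k x y :=
  (Lambda H Q q (latpt A k + u)%R y (Gam A (~` [set k]) x u)).

Let P_shift (j : 'rV[int]_d) (C : set config) : measurable C ->
  P (shift_config j @^-1` C) = P C.
Proof. by case: P_gibbs => + _; exact. Qed.

(* f at the k-th site, the perturbation of that site being p.1 *)
(** The summand of the formula at the site [k], as a function of the perturbation
    of [k] and of those of the other sites. *)
Definition site_value k (p : E * config) : \bar R :=
  (f (latpt A k + u)%R p.1 (Gam A (~` [set k]) p.2 u))%:E.

Lemma measurable_lattice_shift : measurable (lattice_shift A u).
Proof.
rewrite (_ : lattice_shift A u = \bigcup_(k : 'rV[int]_d) [set (latpt A k + u)%R]).
  by apply: countable_bigcup_measurable => k _; exact: measurable_set1_rV.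
by apply/seteqP; split => [_ [k _ <-]|_ [k _ ->]]; exists k.
Qed.

Lemma measurable_site_value k : measurable_fun (lf_domain A) (site_value k).
Proof.
apply/measurable_EFinP.
pose c (p : E * config) : E * E * pconf R d :=
  ((latpt A k + u)%R, p.1, Gam A (~` [set k]) p.2 u).
have mc : measurable_fun setT c.
  apply: measurable_fun_pair.
    by apply: measurable_fun_pair; [exact: measurable_cst|exact: measurable_fst].
  exact: measurableT_comp (measurable_Gam A (~` [set k]) u) measurable_snd.
apply: (measurable_comp (g := c) _ _ f_meas).
- rewrite (_ : [set p | _] = (lattice_shift A u `*` setT) `*` locally_finite).
    apply: measurableX; last exact: measurable_locally_finite.
    by apply: measurableX => //; exact: measurable_lattice_shift.
  by apply/seteqP; split => [p [] ? ?|p [[]]].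
- by move=> _ [p pf <-]; split; [exists k|exact: Gam_locally_finite].
- exact: measurable_funTS.
Qed.

Lemma site_value_update k y y' x :
  site_value k (y, update k y' x) = site_value k (y, x).
Proof. by rewrite /site_value /= Gam_update. Qed.

Let gp k := (site_value k)^\+.
Let gm k := (site_value k)^\-.
Let ga k p := `|site_value k p|.

Let mgp k : measurable_fun (lf_domain A) (gp k).
Proof. by apply: measurable_funepos; exact: measurable_site_value. Qed.
Let mgm k : measurable_fun (lf_domain A) (gm k).
Proof. by apply: measurable_funeneg; exact: measurable_site_value. Qed.
Let mga k : measurable_fun (lf_domain A) (ga k).
Proof. by apply: measurableT_comp => //; exact: measurable_site_value. Qed.
Let gp0 k p : 0 <= gp k p. Proof. exact: funepos_ge0. Qed.
Let gm0 k p : 0 <= gm k p. Proof. exact: funeneg_ge0. Qed.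
Let ga0 k p : 0 <= ga k p. Proof. exact: abse_ge0. Qed.
Let gp_update k y y' x : gp k (y, update k y' x) = gp k (y, x).
Proof. by rewrite /gp !funeposE site_value_update. Qed.
Let gm_update k y y' x : gm k (y, update k y' x) = gm k (y, x).
Proof. by rewrite /gm !funenegE site_value_update. Qed.

Local Notation int_Lambda k x g :=
  (\int[leb]_(y in msupport Q) (g (y, x) * Lambda_at k x y)).

Let int_LambdaE k x :
  int_Lambda k x (site_value k) = int_Lambda k x (gp k) - int_Lambda k x (gm k).
Proof.
rewrite integralE; congr (_ - _); apply: eq_integral => y _.
  by rewrite funeposE /gp funeposE ge0_maxe0M// Lambda_ge0.
by rewrite funenegE /gm funenegE -mulNe ge0_maxe0M// Lambda_ge0.
Qed.

Let int_Lambda_ge0 k x (g : E * config -> \bar R) : (forall p, 0 <= g p) ->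
  0 <= int_Lambda k x g.
Proof. by move=> g0; apply: integral_ge0 => y _; rewrite mule_ge0// Lambda_ge0. Qed.

Let le_int_Lambda k x (g h : E * config -> \bar R) : (forall p, 0 <= g p) ->
  (forall p, g p <= h p) -> int_Lambda k x g <= int_Lambda k x h.
Proof.
move=> g0 gh; apply: ge0_le_integral_nonmeasurable => y _.
  by rewrite mule_ge0// Lambda_ge0.
by rewrite lee_wpmul2r// Lambda_ge0.
Qed.

Let gp_le k p : gp k p <= ga k p.
Proof. by rewrite /gp /ga -/((abse \o site_value k) p) fune_abse leeDl. Qed.

Let gm_le k p : gm k p <= ga k p.
Proof. by rewrite /gm /ga -/((abse \o site_value k) p) fune_abse leeDr. Qed.

(** By the formula for non-negative functions, integrability of the right-hand
    side gives that of the left-hand side, so that positive and negative parts can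
    be subtracted on both sides. *)
Lemma georgii (S : set 'rV[int]_d) :
  \int[P]_(x in config_lf A) (\esum_(k in S)
     \int[leb]_(y in msupport Q) (`|site_value k (y, x)| * Lambda_at k x y)) < +oo ->
  \int[Pr]_w ssum S (fun k => site_value k (X w k, X w)) =
  \int[Pr]_w ssum S (fun k =>
     \int[leb]_(y in msupport Q) (site_value k (y, X w) * Lambda_at k (X w) y)).
Proof.
move=> fin; have mlf := measurable_config_lf A.
have mIp := measurable_esum_Lambda H_ham H_hered H_transl H_case q_meas Q_density u
  mgp gp0 S.
have mIm := measurable_esum_Lambda H_ham H_hered H_transl H_case q_meas Q_density u
  mgm gm0 S.
have mIa := measurable_esum_Lambda H_ham H_hered H_transl H_case q_meas Q_density u
  mga ga0 S.
have I_fin g : (forall k p, 0 <= g k p) -> (forall k p, g k p <= ga k p) ->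
    \int[P]_(x in config_lf A) (\esum_(k in S) int_Lambda k x (g k)) < +oo.
  move=> g0 g_le; apply: le_lt_trans fin; apply: ge0_le_integral_nonmeasurable.
    by move=> x _; apply: esum_ge0 => k _; exact: (int_Lambda_ge0 k x (g0 k)).
  by move=> x _; apply: le_esum => k _; exact: (le_int_Lambda k x (g0 k) (g_le k)).
have Ip_fin := I_fin _ gp0 gp_le; have Im_fin := I_fin _ gm0 gm_le.
have georgii0 g mg g0 g_update := @ge0_georgii _ _ _ A_basis _ _ H_ham H_hered H_transl
  H_case _ q_meas Q_density u _ P_gibbs g mg g0 g_update S.
have own_fin g : (forall k, measurable_fun (lf_domain A) (g k)) ->
    (forall k p, 0 <= g k p) -> (forall k p, g k p <= ga k p) ->
    (forall k y y' x, g k (y, update k y' x) = g k (y, x)) ->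
    \int[P]_(x in config_lf A) (\esum_(k in S) g k (x k, x)) < +oo.
  by move=> mg g0 g_le g_update; rewrite (georgii0 g mg g0 g_update); exact: I_fin.
have own_ge0 (g : 'rV[int]_d -> E * config -> \bar R) x : (forall k p, 0 <= g k p) ->
    config_lf A x -> 0 <= \esum_(k in S) g k (x k, x).
  by move=> g0 _; exact: esum_ge0.
transitivity (\int[P]_(x in config_lf A) (\esum_(k in S) gp k (x k, x)) -
    \int[P]_(x in config_lf A) (\esum_(k in S) gm k (x k, x))).
  apply: (integral_RV_diff A_basis P_shift
    (F := fun x => ssum S (fun k => site_value k (x k, x)))
    (measurable_esum_own_site mgp gp0 S) (measurable_esum_own_site mgm gm0 S)
    (fun x => own_ge0 gp x gp0) (fun x => own_ge0 gm x gm0)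
    (own_fin _ mgp gp0 gp_le gp_update) (own_fin _ mgm gm0 gm_le gm_update)).
  move=> x _ _ _; congr (_ - _); apply: eq_esum => k _.
    by rewrite /gp !funeposE.
  by rewrite /gm !funenegE.
rewrite (georgii0 gp mgp gp0 gp_update) (georgii0 gm mgm gm0 gm_update); symmetry.
have sum_ge0 (g : 'rV[int]_d -> E * config -> \bar R) x : (forall k p, 0 <= g k p) ->
    config_lf A x -> 0 <= \esum_(k in S) int_Lambda k x (g k).
  by move=> g0 _; apply: esum_ge0 => k _; exact: (int_Lambda_ge0 k x (g0 k)).
apply: (integral_RV_diff A_basis P_shift
  (F := fun x => ssum S (fun k =>
    \int[leb]_(y in msupport Q) (site_value k (y, x) * Lambda_at k x y))) mIp mIm
    (fun x => sum_ge0 gp x gp0) (fun x => sum_ge0 gm x gm0) Ip_fin Im_fin).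
move=> x xf Ip_x Im_x; rewrite /ssum -[RHS]esumB//.
- by congr (_ - _); apply: eq_esum => k _; rewrite ?funeposE ?funenegE /= int_LambdaE.
- rewrite /summable; apply: le_lt_trans Ip_x; apply: le_esum => k _.
  by rewrite gee0_abs ?lexx// (int_Lambda_ge0 k x (gp0 k)).
- rewrite /summable; apply: le_lt_trans Im_x; apply: le_esum => k _.
  by rewrite gee0_abs ?lexx// (int_Lambda_ge0 k x (gm0 k)).
- by move=> k _; exact: (int_Lambda_ge0 k x (gp0 k)).
- by move=> k _; exact: (int_Lambda_ge0 k x (gm0 k)).
Qed.

Lemma measurable_integral_abs k : measurable_fun (config_lf A) (fun x =>
  \int[leb]_(y in msupport Q) (`|site_value k (y, x)| * Lambda_at k x y)).
Proof.
exact: (measurable_integral_Lambda H_ham H_hered H_transl H_case q_meas Q_density u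
  k (mga k) (ga0 k)).
Qed.

Lemma georgii_integrable (S : set 'rV[int]_d) :
  \int[Pr]_w (\esum_(k in S)
     \int[leb]_(y in msupport Q) (`|site_value k (y, X w)| * Lambda_at k (X w) y)) < +oo ->
  \int[Pr]_w ssum S (fun k => site_value k (X w k, X w)) =
  \int[Pr]_w ssum S (fun k =>
     \int[leb]_(y in msupport Q) (site_value k (y, X w) * Lambda_at k (X w) y)).
Proof.
move=> fin; apply: georgii; move: fin.
rewrite (ge0_integral_RV A_basis P_shift (F := fun x => \esum_(k in S)
     \int[leb]_(y in msupport Q) (`|site_value k (y, x)| * Lambda_at k x y)))//.
- apply: ge0_measurable_fun_esum => [k|k x _]; first exact: measurable_integral_abs.
  exact: (int_Lambda_ge0 k x (ga0 k)).
- by move=> x _; apply: esum_ge0 => k _; exact: (int_Lambda_ge0 k x (ga0 k)).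
Qed.

Lemma georgii_finite (S : set 'rV[int]_d) : finite_set S ->
  (forall k, S k -> \int[P]_(x in config_lf A)
     \int[leb]_(y in msupport Q) (`|site_value k (y, x)| * Lambda_at k x y) < +oo) ->
  \int[Pr]_w ssum S (fun k => site_value k (X w k, X w)) =
  \int[Pr]_w ssum S (fun k =>
     \int[leb]_(y in msupport Q) (site_value k (y, X w) * Lambda_at k (X w) y)).
Proof.
move=> fS fin; apply: georgii.
have mlf := measurable_config_lf A.
have i0 k x : 0 <= \int[leb]_(y in msupport Q) (`|site_value k (y, x)| * Lambda_at k x y).
  exact: (int_Lambda_ge0 k x (ga0 k)).
rewrite ge0_integral_esum//; last exact: measurable_integral_abs.
rewrite esum_fset//; last by move=> k _; exact: integral_ge0.
rewrite fsbig_finite//= big_seq; apply/lte_sum_pinfty => k.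
by rewrite in_fset_set// inE; exact: fin.
Qed.

End signed.

(** * Stationarity and the finite-volume formula *)

Section stationarity.
Context (R : realType) (d : nat) (A : 'M[R]_d).
Local Notation E := 'rV[R]_d.
Local Notation config := (config R d).
Implicit Types (j k : 'rV[int]_d) (x : config) (y : E).

(** Recentring the points at the site [j] amounts to shifting the perturbations. *)
Lemma Gam_shift_config (S : set 'rV[int]_d) j x u :
  translate (Gam A S x u) (- (latpt A j + u)) =
  Gam A [set k | S (k + j)%R] (shift_config j x) 0%R.
Proof.
have E k : (latpt A (k + j) + x (k + j)%R + u - (latpt A j + u) =
            latpt A k + shift_config j x k + 0)%R.
  rewrite latptD /shift_config addr0 -[RHS](addrK (latpt A j + u)%R); congr (_ - _)%R.
  by rewrite -!addrA; congr (_ + _)%R; rewrite addrCA.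
apply/seteqP; split => [_ [_ [k Sk <-] <-]|_ [k Sk <-]].
  exists (k - j)%R; rewrite /= ?subrK//.
  by rewrite -E subrK.
by exists (latpt A (k + j) + x (k + j) + u)%R; rewrite ?E//; exists (k + j)%R.
Qed.

Lemma config_lf_shift j x : config_lf A x -> config_lf A (shift_config j x).
Proof.
move=> xf; rewrite /config_lf /=.
have := Gam_shift_config setT j x 0%R.
rewrite (_ : [set k | [set: 'rV[int]_d] (k + j)%R] = setT)// => <-.
exact: locally_finite_translate.
Qed.

Lemma shift_configK j : cancel (shift_config (R := R) (- j)%R) (shift_config j).
Proof. by move=> x; apply/funext => k; rewrite /shift_config addrK. Qed.

Lemma integral_shift_config (P : probability config R) j (F : config -> \bar R) :
  (forall C : set config, measurable C -> P (shift_config j @^-1` C) = P C) ->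
  measurable_fun (config_lf A) F -> (forall x, config_lf A x -> 0 <= F x) ->
  \int[P]_(x in config_lf A) F (shift_config j x) = \int[P]_(x in config_lf A) F x.
Proof.
move=> P_shift mF F0; have mlf := measurable_config_lf A.
rewrite [LHS]integral_mkcond [RHS]integral_mkcond.
have mFT : measurable_fun setT (F \_ (config_lf A)).
  by apply/(measurable_restrictT _ _).1.
have FT0 x : 0 <= (F \_ (config_lf A)) x by rewrite erestrict_ge0.
transitivity (\int[P]_x (F \_ (config_lf A)) (shift_config j x)).
  apply: eq_integral => x _; rewrite !patchE.
  congr (if _ then _ else _); apply/idP/idP => /[!inE].
    exact: config_lf_shift.
  by move=> /(config_lf_shift (- j)%R); have := @shift_configK (- j)%R x; rewrite opprK => ->.
apply: (@eq_integral_generator _ _ _ _ _ _ _ P P (shift_config j) id measurable) => //.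
- exact: measurable_shift_config.
- by rewrite sigma_algebra_id//; exact: sigma_algebra_measurable.
- exact: measurableI.
- by rewrite [X in X < _](_ : _ = 1) ?ltry//; exact: probability_setT.
Qed.

Variables (Q : probability E R) (H : pconf R d -> \bar R) (q : E -> \bar R).

Lemma Lambda_translate (i y : E) (g : pconf R d) :
  is_hamiltonian H -> hereditary_hamiltonian H ->
  finite_range H \/ summable_pairwise H -> translation_invariant H ->
  locally_finite g -> Lambda H Q q i y g = Lambda H Q q 0%R y (translate g (- i)%R).
Proof.
move=> H_ham H_hered H_case H_transl gf.
have E z : lambda H q i z g = lambda H q 0%R z (translate g (- i)%R).
  rewrite /lambda /lambda2 -(local_energy_translate H_ham H_hered H_case (i + z)%R (- i)%R)//.
  by rewrite addrAC subrr.
have EI : \int[leb]_(z in msupport Q) lambda H q i z g =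
    \int[leb]_(z in msupport Q) lambda H q 0%R z (translate g (- i)%R).
  by apply: eq_integral => z _; exact: E.
by rewrite /Lambda (E y) EI.
Qed.

End stationarity.

Lemma finite_lattice_sites (R : realType) (d : nat) (A : 'M[R]_d) (u : 'rV[R]_d)
    (W : set 'rV[R]_d) : A \in unitmx -> bounded_rV W ->
  finite_set [set k | W (latpt A k + u)%R].
Proof.
move=> A_basis W_bnd; have [n Wn] := bounded_rVD (- u)%R W_bnd.
apply: (sub_finite_set _ (finite_Lam n A_basis)) => k /= Wk; apply: Wn.
by exists (latpt A k + u)%R => //; rewrite addrK.
Qed.

Unset Implicit Arguments.

Theorem proposition3p7 (R : realType) (d : nat) (d_gt0 : (0 < d)%N)
  (A : 'M[R]_d) (A_basis : A \in unitmx)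
  (Q : probability 'rV[R]_d R)
  (H : pconf R d -> \bar R) (H_ham : is_hamiltonian H)
  (eps B : R)
  (H_stable : stable_hamiltonian H) (H_nondeg : nondegenerate_hamiltonian A H eps B)
  (H_hered : hereditary_hamiltonian H) (H_transl : translation_invariant H)
  (Q_eps : 0 < Q (cball 0%R eps))
  (H_case :
    (finite_range H /\
     exists2 c : R, (0 < c)%R & \int[Q]_x (expR (c * enorm x))%:E < +oo) \/
    (summable_pairwise H /\ bounded_rV (msupport Q)))
  (q : 'rV[R]_d -> \bar R) (q_meas : measurable_fun setT q)
  (q_ninfty : forall x, q x != -oo)
  (Q_density : forall C : set 'rV[R]_d, measurable C ->
     Q C = \int[leb]_(x in C) lambda1 q x)
  (d0 : measure_display) (Omega : measurableType d0)
  (Pr : probability Omega R)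
  (X : {RV Pr >-> config R d}) (U : {RV Pr >-> 'rV[R]_d})
  (Gamma_gibbs : gibbs_perturbed_lattice A H Q X U)
  (u : 'rV[R]_d) (u_D : fundamental_domain A u)
  (f : 'rV[R]_d -> 'rV[R]_d -> pconf R d -> R)
  (f_meas : measurable_fun
     [set p : 'rV[R]_d * 'rV[R]_d * pconf R d |
        lattice_shift A u p.1.1 /\ locally_finite p.2]
     (fun p => f p.1.1 p.1.2 p.2)) :
  ((* (i) *)
   Eu X u (fun x v => \esum_(k in setT)
     `|(f (latpt A k + v)%R (x k) (Gam A (~` [set k]) x v))%:E|) < +oo ->
   Eu X u (fun x v => \esum_(k in setT)
     \int[leb]_(y in msupport Q)
       (`|(f (latpt A k + v)%R y (Gam A (~` [set k]) x v))%:E| *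
        Lambda H Q q (latpt A k + v)%R y (Gam A (~` [set k]) x v))) < +oo ->
   Eu X u (fun x v => ssum setT (fun k =>
     (f (latpt A k + v)%R (x k) (Gam A (~` [set k]) x v))%:E)) =
   Eu X u (fun x v => ssum setT (fun k =>
     \int[leb]_(y in msupport Q)
       ((f (latpt A k + v)%R y (Gam A (~` [set k]) x v))%:E *
        Lambda H Q q (latpt A k + v)%R y (Gam A (~` [set k]) x v)))))
  /\
  ((* (ii) *)
   measurable_fun
     [set p : 'rV[R]_d * pconf R d | msupport Q p.1 /\ locally_finite p.2]
     (fun p => f 0%R p.1 p.2) ->
   (forall (i x : 'rV[R]_d) (g : pconf R d),
      lattice_shift A u i -> msupport Q x -> locally_finite g ->
      f i x g = f 0%R x (translate g (- i)%R)) ->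
   Eu X u (fun x v =>
     \int[leb]_(y in msupport Q)
       (`|(f 0%R y (Gam A (~` [set 0%R]) x 0%R))%:E| *
        Lambda H Q q 0%R y (Gam A (~` [set 0%R]) x 0%R))) < +oo ->
   forall W : set 'rV[R]_d, bounded_rV W ->
   Eu X u (fun x v => ssum [set k | W (latpt A k + v)%R] (fun k =>
     (f (latpt A k + v)%R (x k) (Gam A (~` [set k]) x v))%:E)) =
   Eu X u (fun x v => ssum [set k | W (latpt A k + v)%R] (fun k =>
     \int[leb]_(y in msupport Q)
       ((f (latpt A k + v)%R y (Gam A (~` [set k]) x v))%:E *
        Lambda H Q q (latpt A k + v)%R y (Gam A (~` [set k]) x v))))).
Proof.
have H_alt : finite_range H \/ summable_pairwise H.
  by case: H_case => -[]; [left|right].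
have [P_gibbs _ _] := Gamma_gibbs.
have P_shift : forall (j : 'rV[int]_d) (C : set (config R d)), measurable C ->
    distribution Pr X (shift_config j @^-1` C) = distribution Pr X C by case: P_gibbs.
split=> [_ fin|_ f_inv fin W W_bnd].
  exact: (georgii_integrable A_basis H_ham H_hered H_transl H_alt q_meas Q_density
    P_gibbs f_meas fin).
apply: (georgii_finite A_basis H_ham H_hered H_transl H_alt q_meas Q_density
    P_gibbs f_meas (finite_lattice_sites u A_basis W_bnd)) => k _.
pose I k x := \int[leb]_(y in msupport Q) (`|site_value A u f k (y, x)| *
   Lambda H Q q (latpt A k + u)%R y (Gam A (~` [set k]) x u)).
pose J x := \int[leb]_(y in msupport Q)
  (`|(f 0%R y (Gam A (~` [set 0%R]) x 0%R))%:E| *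
   Lambda H Q q 0%R y (Gam A (~` [set 0%R]) x 0%R)).
have IJ x : config_lf A x -> I k x = J (shift_config k x).
  move=> xf; have gf := Gam_locally_finite (~` [set k]) u xf.
  have gE : Gam A (~` [set 0%R]) (shift_config k x) 0%R =
      translate (Gam A (~` [set k]) x u) (- (latpt A k + u))%R.
    rewrite Gam_shift_config; congr (Gam A _ _ _); apply/seteqP.
    by split=> j /= j0 jk; apply: j0; [apply: (addIr k); rewrite add0r|rewrite jk add0r].
  rewrite /I /J gE; apply: eq_integral => y /[!inE] Qy.
  rewrite -(@Lambda_translate R d Q H q (latpt A k + u)%R y _ H_ham H_hered H_alt H_transl gf) /site_value.
  by rewrite f_inv//; exists k.
have mI : measurable_fun (config_lf A) (I k).
  exact: (measurable_integral_abs H_ham H_hered H_transl H_alt q_meas Q_density f_meas).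
have I0 x : 0 <= I k x.
  by apply: integral_ge0 => y _; rewrite mule_ge0// Lambda_ge0.
have JI x : config_lf A x -> J x = I k (shift_config (- k)%R x).
  by move=> xf; rewrite IJ ?shift_configK//; exact: config_lf_shift.
have EI : \int[distribution Pr X]_(x in config_lf A) I k x =
    \int[distribution Pr X]_(x in config_lf A) J x.
  apply: (etrans (esym (integral_shift_config (fun C => P_shift (- k)%R C) mI
    (fun x _ => I0 x)))).
  by apply: eq_integral => x /[!inE] xf; exact: esym (JI x xf).
have mJ : measurable_fun (config_lf A) J.
  apply: (eq_measurable_fun (fun x => I k (shift_config (- k)%R x))).
    by move=> x /[!inE] xf; exact: esym (JI x xf).
  apply: (measurable_comp (measurable_config_lf A) _ mI).
    by move=> _ [x xf <-]; exact: config_lf_shift.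
  by apply: measurable_funTS; exact: measurable_shift_config.
have J0 x : config_lf A x -> 0 <= J x by move=> xf; rewrite (JI x xf).
have EJ := ge0_integral_RV A_basis P_shift mJ J0.
have fin_I : \int[distribution Pr X]_(x in config_lf A) I k x < +oo.
  by rewrite EI -EJ; exact: fin.
exact: fin_I.
Qed.
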